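(* The Brin-Thompson group $2V$ embeds in (i.e. is isomorphic to a subgroup of) the mapping class group $\mathrm{MCG}(X)$ of the vertex shift $X$ defined by the matrix $$\begin{bmatrix} 1 & 1 & 1 & 0 & 0 & 0 \\ 1 & 1 & 1 & 0 & 0 & 0 \\ 0 & 0 & 0 & 1 & 1 & 1 \\ 0 & 0 & 0 & 1 & 1 & 0 \\ 0 & 0 & 0 & 1 & 1 & 1 \\ 0 & 1 & 1 & 0 & 0 & 0 \end{bmatrix}.$$
   Context: The Brin-Thompson group $2V$ is the group (under composition) of homeomorphisms $f : (\{0,1\}^{\mathbb N})^2 \to (\{0,1\}^{\mathbb N})^2$ such that for some $n \in \mathbb N$ there exist functions $F_1, F_2 : (\{0,1\}^n)^2 \to \{0,1\}^*$ such that $f((ux, vy)) = (F_1(u,v)x, F_2(u,v)y)$ for all $u,v \in \{0,1\}^n$, $x,y \in \{0,1\}^{\mathbb N}$. A subshift is a set of bi-infinite words over a finite alphabet defined by a set of forbidden finite words (equivalently, a closed shift-invariant set); $\sigma$ denotes the shift map, $\sigma(x)_i = x_{i+1}$. The vertex shift defined by a square $0$-$1$ matrix $M$ with rows and columns indexed by a finite set $S$ is the subshift of all $x \in S^{\mathbb Z}$ with $M(x_i,x_{i+1}) = 1$ for all $i\in\mathbb Z$. Mapping class group: let $X$ be a subshift. The mapping torus $\mathbf{S}X$ is the quotient space of $X \times \mathbb R$ by the equivalence relation $(x,t) \cong (\sigma^n(x), t-n)$ for $x \in X$, $t\in\mathbb R$, $n \in \mathbb Z$; write $[x,t]$ for the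 class of $(x,t)$. The path components of $\mathbf{S}X$ are the orbits of the $\mathbb R$-flow $r + [x,t] = [x,t+r]$, and self-homeomorphisms of $\mathbf{S}X$ map orbits onto orbits. Let $\mathcal F(X)$ be the group of self-homeomorphisms of $\mathbf{S}X$ which preserve the natural orientation of each orbit (the one given by the direction of the flow). Elements $f,g \in \mathcal F(X)$ are isotopic if there is a continuous map $h : [0,1]\times \mathbf{S}X \to \mathbf{S}X$ with $h(0,\cdot)=f$, $h(1,\cdot)=g$ and $h(t,\cdot) \in \mathcal F(X)$ for all $t\in[0,1]$. The mapping class group $\mathrm{MCG}(X)$ is the quotient of the group $\mathcal F(X)$ under isotopy. *)

(* Defs.v *)
From HB Require Import structures.
From mathcomp Require Import all_boot all_order all_algebra generic_quotient.
From mathcomp Require Import all_classical all_reals all_analysis.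

Set Implicit Arguments.
Unset Strict Implicit.
Unset Printing Implicit Defensive.

Import Order.TTheory GRing.Theory Num.Theory.
Import numFieldNormedType.Exports.

Local Open Scope classical_set_scope.
Local Open Scope ring_scope.
Local Open Scope quotient_scope.

Definition homeomorphism (T U : topologicalType) (f : T -> U) : Prop :=
  exists g : U -> T, [/\ cancel f g, cancel g f, continuous f & continuous g].

Section HomeoGroup.
Variable T : topologicalType.

Record homeo := Homeo {
  homeo_fun :> T -> T;
  homeo_funP : `[< homeomorphism homeo_fun >] }.

HB.instance Definition _ := [isSub for homeo_fun].
HB.instance Definition _ := [Choice of homeo by <:].

Lemma homeoP (f : homeo) : homeomorphism f.
Proof. exact/asboolP/homeo_funP. Qed.

Lemma homeo_ext (f g : homeo) : f =1 g -> f = g.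
Proof. by move=> fg; apply/val_inj/funext. Qed.

Lemma homeomorphism_id : homeomorphism (@idfun T).
Proof. by exists idfun; split => // x; exact: cvg_id. Qed.

Lemma homeomorphism_comp (f g : T -> T) :
  homeomorphism f -> homeomorphism g -> homeomorphism (f \o g).
Proof.
move=> [f' [fK f'K cf cf']] [g' [gK g'K cg cg']]; exists (g' \o f').
split.
- by move=> x /=; rewrite fK gK.
- by move=> x /=; rewrite g'K f'K.
- by move=> x; apply: continuous_comp; [exact: cg|exact: cf].
- by move=> x; apply: continuous_comp; [exact: cf'|exact: cg'].
Qed.

Definition homeo_one : homeo := Homeo (asboolT homeomorphism_id).

Definition homeo_mul (f g : homeo) : homeo :=
  Homeo (asboolT (homeomorphism_comp (homeoP f) (homeoP g))).

Lemma homeo_inv_subproof (f : homeo) :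
  {g : homeo | cancel f g /\ cancel g f}.
Proof.
apply: cid; have [g [fK gK cf cg]] := homeoP f.
have hg : homeomorphism g by exists f.
by exists (Homeo (asboolT hg)).
Qed.

Definition homeo_inv (f : homeo) : homeo := sval (homeo_inv_subproof f).

Lemma homeoK (f : homeo) : cancel f (homeo_inv f).
Proof. by case: (svalP (homeo_inv_subproof f)). Qed.

Lemma homeoVK (f : homeo) : cancel (homeo_inv f) f.
Proof. by case: (svalP (homeo_inv_subproof f)). Qed.

Lemma homeo_mulA : associative homeo_mul.
Proof. by move=> f g h; apply: homeo_ext. Qed.

Lemma homeo_mul1g : left_id homeo_one homeo_mul.
Proof. by move=> f; apply: homeo_ext. Qed.

Lemma homeo_mulg1 : right_id homeo_one homeo_mul.
Proof. by move=> f; apply: homeo_ext. Qed.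

Lemma homeo_mulVg : left_inverse homeo_one homeo_inv homeo_mul.
Proof. by move=> f; apply: homeo_ext => x /=; exact: homeoK. Qed.

Lemma homeo_mulgV : right_inverse homeo_one homeo_inv homeo_mul.
Proof. by move=> f; apply: homeo_ext => x /=; exact: homeoVK. Qed.

HB.instance Definition _ := isGroup.Build homeo
  homeo_mulA homeo_mul1g homeo_mulg1 homeo_mulVg homeo_mulgV.

Lemma homeo_mulE (f g : homeo) x : (f * g)%g x = f (g x).
Proof. by []. Qed.

Lemma homeo_invK (f : homeo) : cancel f (f^-1)%g.
Proof. exact: homeoK. Qed.

Lemma homeo_invVK (f : homeo) : cancel (f^-1)%g f.
Proof. exact: homeoVK. Qed.

Lemma homeo_continuous (f : homeo) : continuous f.
Proof. by have [g []] := homeoP f. Qed.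

End HomeoGroup.

Definition prefix_cat (w : seq bool) (x : cantor_space) : cantor_space :=
  fun i => if (i < size w)%N then nth false w i else x (i - size w)%N.

Definition acts_by_prefixes (f : cantor_space * cantor_space ->
    cantor_space * cantor_space) : Prop :=
  exists (n : nat) (F1 F2 : n.-tuple bool * n.-tuple bool -> seq bool),
    forall (u v : n.-tuple bool) (x y : cantor_space),
      f (prefix_cat u x, prefix_cat v y) =
      (prefix_cat (F1 (u, v)) x, prefix_cat (F2 (u, v)) y).

Lemma prefix_cat_cat s t x :
  prefix_cat (s ++ t) x = prefix_cat s (prefix_cat t x).
Proof.
apply/funext => i; rewrite /prefix_cat size_cat nth_cat.
case: (ltnP i (size s)) => h; first by rewrite ltn_addr.
by rewrite ltn_subLR // subnDA.
Qed.

Lemma prefix_cat0 x : prefix_cat [::] x = x.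
Proof. by apply/funext => i; rewrite /prefix_cat subn0. Qed.

Lemma prefix_cat_mkseq n (x : cantor_space) :
  x = prefix_cat (mkseq x n) (fun i => x (n + i)%N).
Proof.
apply/funext => i; rewrite /prefix_cat size_mkseq.
by case: ltnP => h; [rewrite nth_mkseq|rewrite subnKC].
Qed.

Lemma prefix_cat_drop s t x y : (size s <= size t)%N ->
  prefix_cat s x = prefix_cat t y -> t = s ++ drop (size s) t.
Proof.
move=> st e; apply: (@eq_from_nth _ false).
  by rewrite size_cat size_drop subnKC.
move=> i it; rewrite nth_cat; case: ltnP => h.
  by move/(congr1 (@^~ i)): e; rewrite /prefix_cat h it.
by rewrite nth_drop subnKC.
Qed.

Lemma acts_by_prefixesP f : acts_by_prefixes f <->
  exists n, forall u v : seq bool, size u = n -> size v = n ->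
    exists s t, forall x y,
      f (prefix_cat u x, prefix_cat v y) = (prefix_cat s x, prefix_cat t y).
Proof.
split=> [[n [F1 [F2 fE]]]|[n H]].
  exists n => u v /eqP su /eqP sv; exists (F1 (Tuple su, Tuple sv)).
  by exists (F2 (Tuple su, Tuple sv)) => x y; rewrite -fE.
have {}H : forall p : n.-tuple bool * n.-tuple bool,
    exists q : seq bool * seq bool, forall x y,
    f (prefix_cat p.1 x, prefix_cat p.2 y) =
      (prefix_cat q.1 x, prefix_cat q.2 y).
  move=> [u v] /=.
  have [s [t st]] := H u v (size_tuple u) (size_tuple v).
  by exists (s, t).
have [F FE] := choice H.
by exists n, (fst \o F), (snd \o F) => u v x y; rewrite (FE (u, v)).
Qed.

Lemma acts_by_prefixes_comp f g :
  acts_by_prefixes f -> acts_by_prefixes g -> acts_by_prefixes (f \o g).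
Proof.
move=> /acts_by_prefixesP[n fH] /acts_by_prefixesP[m gH].
apply/acts_by_prefixesP; exists (m + n)%N => u v su sv.
have [||s [t gE]] := gH (take m u) (take m v).
- by rewrite size_takel // su leq_addr.
- by rewrite size_takel // sv leq_addr.
pose s1 := s ++ drop m u; pose t1 := t ++ drop m v.
have ns : (n <= size s1)%N.
  by rewrite size_cat size_drop su addKn leq_addl.
have nt : (n <= size t1)%N.
  by rewrite size_cat size_drop sv addKn leq_addl.
have [||s' [t' fE]] := fH (take n s1) (take n t1); rewrite ?size_takel //.
exists (s' ++ drop n s1), (t' ++ drop n t1) => x y /=.
rewrite -{1}(cat_take_drop m u) -{1}(cat_take_drop m v).
rewrite 2!prefix_cat_cat gE -2!prefix_cat_cat -/s1 -/t1.
rewrite -{1}(cat_take_drop n s1) -{1}(cat_take_drop n t1).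
by rewrite 2!prefix_cat_cat fE -2!prefix_cat_cat.
Qed.

Lemma acts_by_prefixes_inv f g :
  cancel f g -> cancel g f -> acts_by_prefixes f -> acts_by_prefixes g.
Proof.
move=> fK gK [n [F1 [F2 fE]]]; apply/acts_by_prefixesP.
pose m := (\max_p maxn (size (F1 p)) (size (F2 p)))%N.
have m1 p : (size (F1 p) <= m)%N.
  apply: leq_trans (leq_maxl _ (size (F2 p))) _.
  exact: (leq_bigmax p).
have m2 p : (size (F2 p) <= m)%N.
  apply: leq_trans (leq_maxr (size (F1 p)) _) _.
  exact: (leq_bigmax p).
exists m => u v su sv.
pose z : cantor_space := fun=> false.
case ab: (g (prefix_cat u z, prefix_cat v z)) => [a b].
pose p : n.-tuple bool * n.-tuple bool :=
  (Tuple (introT eqP (size_mkseq a n)), Tuple (introT eqP (size_mkseq b n))).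
have /esym := gK (prefix_cat u z, prefix_cat v z).
rewrite ab (prefix_cat_mkseq n a) (prefix_cat_mkseq n b) (fE p.1 p.2).
case=> /esym /prefix_cat_drop e1 /esym /prefix_cat_drop e2.
exists (p.1 ++ drop (size (F1 p)) u), (p.2 ++ drop (size (F2 p)) v) => x y.
rewrite {1}e1 ?su // {1}e2 ?sv // !prefix_cat_cat.
by apply: (can_inj fK); rewrite gK fE.
Qed.

Definition in_2V (f : homeo (cantor_space * cantor_space)%type) : bool :=
  `[< acts_by_prefixes f >].

Record brin_thompson_2V := BrinThompson2V {
  brin_thompson_val :> homeo (cantor_space * cantor_space)%type;
  brin_thompson_valP : in_2V brin_thompson_val }.

HB.instance Definition _ := [isSub for brin_thompson_val].
HB.instance Definition _ := [Choice of brin_thompson_2V by <:].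

Lemma in_2V_group_closed : group_closed in_2V.
Proof.
split; first apply/asboolP.
  exists 0%N, (fun=> [::]), (fun=> [::]) => u v x y.
  by rewrite (tuple0 u) (tuple0 v) !prefix_cat0.
move=> f g /asboolP Hf /asboolP Hg; apply/asboolP.
apply: acts_by_prefixes_comp Hf _.
by apply: acts_by_prefixes_inv Hg; [exact: homeo_invK|exact: homeo_invVK].
Qed.

HB.instance Definition _ :=
  SubChoice_isSubGroup.Build _ _ brin_thompson_2V in_2V_group_closed.

Lemma continuous_pair (T U V : topologicalType) (f : T -> U) (g : T -> V) :
  continuous f -> continuous g -> continuous (fun x => (f x, g x)).
Proof. by move=> cf cg x; apply: cvg_pair; [exact: cf|exact: cg]. Qed.

Lemma continuous_fst (U V : topologicalType) : continuous (@fst U V).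
Proof. by move=> x; exact: cvg_fst. Qed.

Lemma continuous_snd (U V : topologicalType) : continuous (@snd U V).
Proof. by move=> x; exact: cvg_snd. Qed.

Lemma within_comp (T U V : topologicalType) (A : set U) (B : set T)
    (h : U -> V) (phi : T -> U) :
  {within A, continuous h} -> continuous phi -> B `<=` phi @^-1` A ->
  {within B, continuous (h \o phi)}.
Proof.
move=> /continuousP hc /continuousP pc BA; apply/continuousP => W oW.
have /open_subspaceP[V' oV' VE] := hc _ oW.
apply/open_subspaceP; exists (phi @^-1` V'); first exact: pc.
rewrite eqEsubset; split=> x [Vx Bx]; split => //.
  by have [] : (h @^-1` W `&` A) (phi x) by rewrite -VE; split => //; exact: BA.
by have [] : (V' `&` A) (phi x) by rewrite VE; split => //; exact: BA.
Qed.

Section MappingTorus.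
Variable S : finType.

Definition full_shift : Type := prod_topology (fun _ : int => discrete_topology S).

HB.instance Definition _ := Topological.on full_shift.

(* [shift n] is sigma^n, where sigma = [shift 1], for every integer n. *)
Definition shift (n : int) (x : full_shift) : full_shift := fun i => x (i + n).

Lemma shift_comp m n x : shift m (shift n x) = shift (n + m) x.
Proof. by apply/funext => i; rewrite /shift addrAC addrA. Qed.

Lemma shift0 x : shift 0 x = x.
Proof. by apply/funext => i; rewrite /shift addr0. Qed.

Record subshift := Subshift {
  subshift_set :> set full_shift;
  subshift_closed : closed subshift_set;
  subshift_invariant : shift 1 @` subshift_set = subshift_set }.

Variables (R : realType) (X : subshift).

Definition torus_rel (p q : X * R) : bool :=
  `[< exists n : int,
        set_val q.1 = shift n (set_val p.1) /\ q.2 = p.2 - n%:~R >].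

Lemma torus_rel_refl : reflexive torus_rel.
Proof.
by move=> p; apply/asboolP; exists 0; rewrite shift0 subr0.
Qed.

Lemma torus_rel_sym : symmetric torus_rel.
Proof.
suff sub p q : torus_rel p q -> torus_rel q p.
  by move=> p q; apply/idP/idP; exact: sub.
move=> /asboolP[n [e1 e2]]; apply/asboolP; exists (- n); split.
  by rewrite e1 shift_comp subrr shift0.
by rewrite e2 mulrNz opprK subrK.
Qed.

Lemma torus_rel_trans : transitive torus_rel.
Proof.
move=> q p r /asboolP[m [e1 e2]] /asboolP[n [e3 e4]].
apply/asboolP; exists (m + n); split; first by rewrite e3 e1 shift_comp.
by rewrite e4 e2 intrD opprD addrA.
Qed.

Definition torus_equiv :=
  EquivRel torus_rel torus_rel_refl torus_rel_sym torus_rel_trans.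

Definition mapping_torus : Type := {eq_quot torus_equiv}.

HB.instance Definition _ := Quotient.on mapping_torus.
HB.instance Definition _ :=
  Topological.copy mapping_torus (quotient_topology mapping_torus).

Definition torus_class (x : X) (t : R) : mapping_torus :=
  \pi_mapping_torus (x, t).

Lemma torus_classP (x y : X) (s t : R) :
  torus_class x s = torus_class y t <->
  exists n : int, set_val y = shift n (set_val x) /\ t = s - n%:~R.
Proof. by split=> [/eqmodP/asboolP//|H]; apply/eqmodP/asboolP. Qed.

Lemma torus_class_repr z : torus_class (repr z).1 (repr z).2 = z.
Proof. by rewrite /torus_class -surjective_pairing reprK. Qed.

Definition flow (r : R) (z : mapping_torus) : mapping_torus :=
  torus_class (repr z).1 ((repr z).2 + r).

Lemma flowE r x t : flow r (torus_class x t) = torus_class x (t + r).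
Proof.
have := torus_class_repr (torus_class x t); rewrite /flow.
move: (repr _) => [y s] /= /torus_classP[n [e1 ->]].
by apply/torus_classP; exists n; rewrite e1 addrAC.
Qed.

(* [r |-> flow r z] parametrizes the orbit of z: bijectively if the orbit is a
   line, as a universal covering if it is a circle.  [theta] is f read in these
   parametrizations at z and at f z, i.e. a lift of f on the orbit; f preserves
   the orientation of the orbit when this lift is an increasing homeomorphism
   of the real line. *)
Definition preserves_orientation (f : mapping_torus -> mapping_torus) : Prop :=
  forall z : mapping_torus, exists theta : R -> R,
    [/\ homeomorphism theta, {homo theta : s t / s < t} &
        forall r, f (flow r z) = flow (theta r) (f z)].

Definition in_torus_group (f : homeo mapping_torus) : bool :=
  `[< preserves_orientation f >].

Record torus_group := TorusGroup {
  torus_group_val :> homeo mapping_torus;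
  torus_group_valP : in_torus_group torus_group_val }.

HB.instance Definition _ := [isSub for torus_group_val].
HB.instance Definition _ := [Choice of torus_group by <:].

Lemma in_torus_group_closed : group_closed in_torus_group.
Proof.
split; first apply/asboolP.
  move=> z; exists idfun; split => //.
  exact: homeomorphism_id.
move=> f g /asboolP Hf /asboolP Hg; apply/asboolP => z.
have [k [hk kmono kE]] := Hg ((g^-1)%g z).
have [th [hth thmono thE]] := Hf ((g^-1)%g z).
have [k' [kK k'K ck ck']] := hk.
have kmono' : {mono k : s t / s < t} by apply/leW_mono/le_mono.
exists (th \o k'); split.
- by apply: homeomorphism_comp => //; exists k.
- by move=> s t st /=; apply: thmono; rewrite -kmono' !k'K.
move=> r; rewrite !homeo_mulE /= -thE; congr (f _).
apply: (can_inj (homeo_invK g)).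
by rewrite homeo_invVK kE k'K homeo_invVK.
Qed.

HB.instance Definition _ :=
  SubChoice_isSubGroup.Build _ _ torus_group in_torus_group_closed.

Lemma torus_group_mulE (f g : torus_group) z : (f * g)%g z = f (g z).
Proof. by []. Qed.

Lemma torus_group_ext (f g : torus_group) : f =1 g -> f = g.
Proof. by move=> fg; apply/val_inj/homeo_ext. Qed.

Definition isotopic (f g : torus_group) : Prop :=
  exists h : R * mapping_torus -> mapping_torus,
    [/\ {within `[0, 1] `*` setT, continuous h},
        forall z, h (0, z) = f z,
        forall z, h (1, z) = g z &
        forall t : R, 0 <= t <= 1 ->
          exists k : torus_group, forall z, h (t, z) = k z].

Lemma isotopic_refl f : isotopic f f.
Proof.
exists (fun p => f p.2); split => //; last by move=> t _; exists f.
apply: continuous_subspaceT => p.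
apply: (@continuous_comp _ _ _ snd f); first exact: continuous_snd.
exact: homeo_continuous.
Qed.

Lemma isotopic_sym f g : isotopic f g -> isotopic g f.
Proof.
move=> [h [hc h0 h1 hF]].
pose phi (p : R * mapping_torus) := (1 - p.1, p.2).
exists (h \o phi); split.
- apply: (@within_comp _ _ _ _ _ h phi hc).
    apply: continuous_pair; last exact: continuous_snd.
    by move=> p; apply: cvgB; [exact: cvg_cst|exact: continuous_fst].
  move=> [t z] /= [+ _]; rewrite in_itv /= => /andP[t0 t1]; split => //=.
  by rewrite in_itv /= subr_ge0 t1 lerBlDr lerDl.
- by move=> z; rewrite /= /phi subr0.
- by move=> z; rewrite /= /phi subrr.
- move=> t /andP[t0 t1]; apply: (hF (1 - t)).
  by rewrite subr_ge0 t1 lerBlDr lerDl.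
Qed.

Lemma isotopic_trans f g k : isotopic f g -> isotopic g k -> isotopic f k.
Proof.
move=> [h1 [c1 h10 h11 F1]] [h2 [c2 h20 h21 F2]].
pose a1 (p : R * mapping_torus) := (2 * p.1, p.2).
pose a2 (p : R * mapping_torus) := (2 * p.1 - 1, p.2).
pose h p := if p.1 <= 2^-1 then h1 (a1 p) else h2 (a2 p).
have ca1 : continuous a1.
  apply: continuous_pair; last exact: continuous_snd.
  by move=> p; apply: cvgM; [exact: cvg_cst|exact: continuous_fst].
have ca2 : continuous a2.
  apply: continuous_pair; last exact: continuous_snd.
  move=> p; apply: cvgB; last exact: cvg_cst.
  by apply: cvgM; [exact: cvg_cst|exact: continuous_fst].
pose A : set (R * mapping_torus) := `[0, 2^-1] `*` setT.
pose B : set (R * mapping_torus) := `[2^-1, 1] `*` setT.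
have AE : A = fst @^-1` `[0, 2^-1].
  by rewrite eqEsubset; split => [p []|p].
have BE : B = fst @^-1` `[2^-1, 1].
  by rewrite eqEsubset; split => [p []|p].
have clA : closed A.
  rewrite AE; apply: closed_comp; last exact: interval_closed.
  by move=> p _; exact: continuous_fst.
have clB : closed B.
  rewrite BE; apply: closed_comp; last exact: interval_closed.
  by move=> p _; exact: continuous_fst.
exists h; split.
- have -> : `[0, 1] `*` [set: mapping_torus] = A `|` B.
    rewrite AE BE eqEsubset; split => [[t z] [/= + _]|[t z] []] /=;
      rewrite !in_itv /=.
    + move=> /andP[t0 t1]; case: (leP t 2^-1) => ht; [left|right];
        by rewrite ?t0 ?t1 ?andbT ?(ltW ht).
    + by move=> /andP[t0 t1]; split => //; rewrite t0 (le_trans t1) // invf_le1 // ler1n.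
    + by move=> /andP[t0 t1]; split => //; rewrite t1 (le_trans _ t0) // invr_ge0.
  apply: withinU_continuous => //.
  + have : {within A, continuous (h1 \o a1)}.
      apply: (@within_comp _ _ _ _ _ h1 a1 c1 ca1) => -[t z] [/= + _]; rewrite in_itv /=.
      move=> /andP[t0 t1]; split => //=; rewrite in_itv /= mulr_ge0 //=.
      by rewrite -ler_pdivlMl // mulr1.
    apply: subspace_eq_continuous => -[t z] /set_mem[/= + _].
    rewrite in_itv /= => /andP[_ ht].
    by change (h1 (a1 (t, z)) = h (t, z)); rewrite /h /= ht.
  + have : {within B, continuous (h2 \o a2)}.
      apply: (@within_comp _ _ _ _ _ h2 a2 c2 ca2) => -[t z] [/= + _]; rewrite in_itv /=.
      move=> /andP[t0 t1]; split => //=; rewrite in_itv /=.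
      rewrite subr_ge0 -ler_pdivrMl // mulr1 t0 /= lerBlDr.
      by rewrite -[1 + 1](mulr1 2) ler_pM2l.
    apply: subspace_eq_continuous => -[t z] /set_mem[/= + _].
    rewrite in_itv /= => /andP[t0 _].
    change (h2 (a2 (t, z)) = h (t, z)); rewrite /h /=.
    case: ifPn => // t1; have -> : t = 2^-1 by apply/le_anti/andP.
    by rewrite /a1 /a2 /= mulfV ?pnatr_eq0 // subrr h20 h11.
- by move=> z; rewrite /h /a1 /= invr_ge0 ler0n mulr0 h10.
- move=> z; rewrite /h /a2 /= ifN ?mulr1.
    by rewrite -h21; congr (h2 (_, _)); rewrite -[2]/(1 + 1) addrK.
  by rewrite -ltNge invf_lt1 // ltr1n.
move=> t /andP[t0 t1]; rewrite /h /a1 /a2 /=.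
case: leP => ht; [apply: (F1 (2 * t))|apply: (F2 (2 * t - 1))].
  by rewrite mulr_ge0 //= -ler_pdivlMl // mulr1.
rewrite subr_ge0 -ler_pdivrMl // mulr1 (ltW ht) /= lerBlDr.
by rewrite -[1 + 1](mulr1 2) ler_pM2l.
Qed.

Lemma isotopic_mull k f g : isotopic f g -> isotopic (k * f)%g (k * g)%g.
Proof.
move=> [h [hc h0 h1 hF]]; exists (k \o h); split.
- apply: within_continuous_comp hc => z _; exact: homeo_continuous.
- by move=> z /=; rewrite h0.
- by move=> z /=; rewrite h1.
- move=> t /hF[l lE]; exists (k * l)%g => z /=.
  by rewrite lE.
Qed.

Lemma isotopic_mulr k f g : isotopic f g -> isotopic (f * k)%g (g * k)%g.
Proof.
move=> [h [hc h0 h1 hF]].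
pose phi (p : R * mapping_torus) := (p.1, k p.2).
exists (h \o phi); split.
- apply: (@within_comp _ _ _ _ _ h phi hc); last by move=> [t z] [].
  apply: continuous_pair; first exact: continuous_fst.
  move=> p; apply: (@continuous_comp _ _ _ snd k); first exact: continuous_snd.
  exact: homeo_continuous.
- by move=> z; rewrite /= /phi h0.
- by move=> z; rewrite /= /phi h1.
- by move=> t /hF[l lE]; exists (l * k)%g => z; rewrite /= /phi lE.
Qed.

Lemma isotopic_mul f f' g g' :
  isotopic f f' -> isotopic g g' -> isotopic (f * g)%g (f' * g')%g.
Proof.
move=> ff' gg'; apply: isotopic_trans (isotopic_mull f gg') _.
exact: isotopic_mulr.
Qed.

Lemma isotopic_inv f g : isotopic f g -> isotopic (f^-1)%g (g^-1)%g.
Proof.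
move=> fg; apply: isotopic_sym.
have := isotopic_mulr (g^-1)%g (isotopic_mull (f^-1)%g fg).
by rewrite mulVg mul1g -mulgA mulgV mulg1.
Qed.

Definition isotopicb (f g : torus_group) : bool := `[< isotopic f g >].

Lemma isotopicb_refl : reflexive isotopicb.
Proof. by move=> f; apply/asboolP; exact: isotopic_refl. Qed.

Lemma isotopicb_sym : symmetric isotopicb.
Proof.
by move=> f g; apply/asboolP/asboolP; exact: isotopic_sym.
Qed.

Lemma isotopicb_trans : transitive isotopicb.
Proof.
by move=> g f k /asboolP fg /asboolP gk; apply/asboolP/(isotopic_trans fg gk).
Qed.

Definition isotopy_equiv :=
  EquivRel isotopicb isotopicb_refl isotopicb_sym isotopicb_trans.

Definition mapping_class_group : Type := {eq_quot isotopy_equiv}.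

HB.instance Definition _ := Quotient.on mapping_class_group.
HB.instance Definition _ := Choice.on mapping_class_group.

Definition isotopy_class (f : torus_group) : mapping_class_group :=
  \pi_mapping_class_group f.

Lemma isotopy_classP f g : isotopy_class f = isotopy_class g <-> isotopic f g.
Proof.
by split => [/eqmodP/asboolP//|fg]; apply/eqmodP/asboolP.
Qed.

Definition mcg_one : mapping_class_group := isotopy_class 1%g.

Definition mcg_mul (a b : mapping_class_group) : mapping_class_group :=
  isotopy_class (repr a * repr b)%g.

Definition mcg_inv (a : mapping_class_group) : mapping_class_group :=
  isotopy_class ((repr a)^-1)%g.

Lemma isotopic_repr f : isotopic (repr (isotopy_class f)) f.
Proof. by apply/isotopy_classP; rewrite /isotopy_class reprK. Qed.

Lemma isotopy_classK a : isotopy_class (repr a) = a.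
Proof. by rewrite /isotopy_class reprK. Qed.

Lemma mcg_mulE f g :
  mcg_mul (isotopy_class f) (isotopy_class g) = isotopy_class (f * g)%g.
Proof. by apply/isotopy_classP/isotopic_mul; exact: isotopic_repr. Qed.

Lemma mcg_invE f : mcg_inv (isotopy_class f) = isotopy_class (f^-1)%g.
Proof. by apply/isotopy_classP/isotopic_inv/isotopic_repr. Qed.

Lemma mcg_mulA : associative mcg_mul.
Proof.
move=> a b c; rewrite -(isotopy_classK a) -(isotopy_classK b).
by rewrite -(isotopy_classK c) !mcg_mulE mulgA.
Qed.

Lemma mcg_mul1g : left_id mcg_one mcg_mul.
Proof. by move=> a; rewrite -(isotopy_classK a) mcg_mulE mul1g. Qed.

Lemma mcg_mulg1 : right_id mcg_one mcg_mul.
Proof. by move=> a; rewrite -(isotopy_classK a) mcg_mulE mulg1. Qed.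

Lemma mcg_mulVg : left_inverse mcg_one mcg_inv mcg_mul.
Proof.
by move=> a; rewrite -(isotopy_classK a) mcg_invE mcg_mulE mulVg.
Qed.

Lemma mcg_mulgV : right_inverse mcg_one mcg_inv mcg_mul.
Proof.
by move=> a; rewrite -(isotopy_classK a) mcg_invE mcg_mulE mulgV.
Qed.

HB.instance Definition _ := isGroup.Build mapping_class_group
  mcg_mulA mcg_mul1g mcg_mulg1 mcg_mulVg mcg_mulgV.

End MappingTorus.

Section VertexShift.
Variables (n : nat) (M : 'M[nat]_n).

Definition vertex_shift_set : set (full_shift 'I_n) :=
  [set x | forall i : int, M (x i) (x (i + 1)) = 1%N].

Lemma vertex_shift_closed : closed vertex_shift_set.
Proof.
have -> : vertex_shift_set =
    \bigcap_(i : int) [set x : full_shift 'I_n | M (x i) (x (i + 1)) = 1%N].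
  by rewrite eqEsubset; split => [x Hx i _|x Hx i]; [exact: Hx|exact: (Hx i)].
apply: closed_bigI => i _.
pose phi (x : full_shift 'I_n) := M (x i) (x (i + 1)).
have pc j : continuous (fun x : full_shift 'I_n => x j : discrete_topology 'I_n).
  exact: (@proj_continuous _ (fun _ : int => discrete_topology 'I_n) j).
rewrite -[X in closed X]setCK; apply: open_closedC.
rewrite openE => x /= Hx; rewrite /interior.
have Hn j : \forall y \near x, y j = x j.
  exact: (pc j x _ (@discrete_set1 (discrete_topology 'I_n) (x j))).
near=> y => /=.
have -> : y i = x i by near: y; exact: Hn.
have -> // : y (i + 1) = x (i + 1) by near: y; exact: Hn.
Unshelve. all: by end_near.
Qed.

Lemma vertex_shift_invariant : shift 1 @` vertex_shift_set = vertex_shift_set.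
Proof.
rewrite eqEsubset; split => [_ [x Hx <-] i|x Hx]; first exact: Hx.
exists (shift (-1) x); last by rewrite shift_comp addNr shift0.
by move=> i; rewrite /shift addrAC; exact: Hx.
Qed.

Definition vertex_shift : subshift 'I_n :=
  Subshift vertex_shift_closed vertex_shift_invariant.

End VertexShift.

Definition matrix_of_rows (n : nat) (rows : seq (seq nat)) : 'M[nat]_n :=
  \matrix_(i, j) nth 0%N (nth [::] rows i) j.

(* Main.v *)
From HB Require Import structures.
Require Import Defs.
From mathcomp Require Import all_boot all_order all_algebra generic_quotient.
From mathcomp Require Import all_classical all_reals all_analysis.
From mathcomp Require Import zify ring lra.
(* Gives [shift] the meaning of the shift map again. *)
Import Defs.

Set Implicit Arguments.
Unset Strict Implicit.
Unset Printing Implicit Defensive.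

Import Order.TTheory GRing.Theory Num.Theory.
Import numFieldNormedType.Exports.

Local Open Scope classical_set_scope.
Local Open Scope ring_scope.
Local Open Scope quotient_scope.

(** A point of the vertex shift is a succession of cells. Call the symbol [s2] a
    centre and [s5] a marker. A cell consists of a marker, a word over [s0] and
    [s1], a centre, a word over [s3] and [s4], and the marker of the next cell.
    Both words are binary words when they are read away from the centre, and
    the matrix forces them to end in a one when they are finite and not empty.
    Hence finite words correspond to the finitely supported points of the
    Cantor space, while an infinite word is an arbitrary point of it. An
    element [f] of 2V preserves finite support in both coordinates, because it
    only exchanges prefixes, so it acts on the pair of tapes of every cell, on
    all cells at the same time. It changes a bounded neighbourhood of the centre
    and copies the rest, so that its action is given by a local rule
    [code_block], whose blocks have variable length.

    As the lengths of the cells change, the action lives on the mapping torus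
    and not on the shift, and the time along the flow has to be changed too. In
    each half of a cell, if the length grows by [a], then the distance to the
    centre is changed by [slide a], the time [a] map of a flow on the half-line
    that fixes the centre and is a translation at unit speed at distance at
    least one. These maps form a one-parameter group. Thus the homeomorphisms
    [torus_map f] compose exactly as the elements of 2V do, already before
    passing to isotopy classes. Being translations away from the centre, the
    slides are visible only near a centre, and the definition also makes sense
    where cells are infinite.

    The properties of the block code and of the change of time are computed on
    the recurrent points, those with markers unboundedly far on both sides,
    where all the cells are finite and have an explicit image ([code_cell],
    [code_time_cell], [cellwise_eq]). They extend to all points since the
    recurrent points are dense ([recurrent_dense]), the codes are locally
    constant ([block_code_local], [code_time_local]), and the mapping torus is
    Hausdorff ([torus_dense_eq]).

    For injectivity, the path components of the mapping torus are the orbits of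
    the flow ([path_orbit]), so isotopic maps send a given point into the same
    orbit. If the class of [torus_map f] is trivial, consider the point with a
    single centre and two infinite tapes [a] and [b]. Its image has a single
    centre and the tapes [f (a, b)], and it is on the same orbit as the point
    itself. Therefore [f (a, b) = (a, b)] ([code_map_orbits_id]). *)

(** * Cylinders and the topology of the mapping torus *)

Definition agree (S : Type) (m : nat) (x y : int -> S) : Prop :=
  forall i : int, `|i| <= m%:Z -> x i = y i.

Lemma agreeW (S : Type) (m k : nat) (x y : int -> S) :
  (k <= m)%N -> agree m x y -> agree k x y.
Proof. by move=> km xy i ik; apply: xy; lia. Qed.

Lemma agree_trans (S : Type) (m : nat) (x y z : int -> S) :
  agree m x y -> agree m y z -> agree m x z.
Proof. by move=> xy yz i im; rewrite xy ?yz. Qed.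

Section CylinderTopology.
Variable S : finType.

Lemma agree_nbhs (m : nat) (x : full_shift S) :
  nbhs x [set y : full_shift S | agree m x y].
Proof.
have pc j : continuous (fun y : full_shift S => y j : discrete_topology S).
  exact: (@proj_continuous _ (fun _ : int => discrete_topology S) j).
have coord j : \forall y \near x, y j = x j.
  exact: (pc j x _ (@discrete_set1 (discrete_topology S) (x j))).
have : \forall y \near x, forall j, j \in [seq k%:Z | k <- iota 0 m.+1] ->
    x j = y j /\ x (- j) = y (- j).
  elim: [seq k%:Z | k <- iota 0 m.+1] => [|a s IH].
    by apply: (@filterE _ (nbhs x)) => y j; rewrite in_nil.
  near=> y => j; rewrite in_cons => /orP[/eqP ->|js].
    by split; apply/esym; near: y; exact: coord.
  by move: j js; near: y; exact: IH.
apply: (@filterS _ (nbhs x)) => y H i im.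
have [i0|i0] := leP 0 i.
  apply: (H i _).1; apply/mapP; exists `|i|%N; last by lia.
  by rewrite mem_iota; lia.
have := (H (- i) _).2; rewrite opprK; apply.
apply/mapP; exists `|i|%N; last by lia.
by rewrite mem_iota; lia.
Unshelve. all: by end_near.
Qed.

(** The filter generated by the cylinders around [x] converges to [x] in every
    coordinate, hence in the product topology. *)
Lemma nbhs_full_shift (x : full_shift S) (U : set (full_shift S)) :
  nbhs x U -> exists m, forall y, agree m x y -> U y.
Proof.
pose cyl m := [set y : full_shift S | agree m x y].
pose F := filter_from [set: nat] cyl.
have FF : Filter F.
  apply: filter_from_filter; first by exists 0%N.
  move=> i j _ _; exists (maxn i j) => // y H.
  by split; apply: agreeW H; [exact: leq_maxl|exact: leq_maxr].
have : F --> x.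
  apply/cvg_sup => j U' [_ [[B _ <-] /= Bx] sBU].
  apply: (@filterS _ F _ _ _ sBU).
  exists `|j|%N => // y H /=; rewrite -(H j) //; lia.
by move=> /(_ U) + xU => /(_ xU)[m _ H]; exists m => y /H.
Qed.

Variable X : subshift S.

Lemma nbhs_subshiftP (x : X) (U : set X) :
  nbhs x U <-> exists m, forall y : X, agree m (set_val x) (set_val y) -> U y.
Proof.
split=> [|[m H]].
  rewrite nbhsE => -[_ [[B oB <-] /= Bx] sBU].
  have [|m Hm] := @nbhs_full_shift (set_val x) B.
    by apply: open_nbhs_nbhs.
  by exists m => y /Hm By; apply: sBU.
have nx := agree_nbhs m (set_val x).
have := @initial_continuous X (full_shift S) set_val x _ nx.
apply: (@filterS _ (nbhs x)).
by move=> y /= /H.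
Qed.

Variable R : realType.
Local Notation torus := (mapping_torus R X).

Lemma torus_class_shift (x y : X) (t : R) (n : int) :
  set_val y = shift n (set_val x) -> torus_class y (t - n%:~R) = torus_class x t.
Proof. by move=> e; apply/esym/torus_classP; exists n. Qed.

Lemma subshift_shift (n : int) (x : full_shift S) :
  subshift_set X x -> subshift_set X (shift n x).
Proof.
have inv := subshift_invariant X.
have fwd (y : full_shift S) : subshift_set X y -> subshift_set X (shift 1 y).
  by move=> Xy; rewrite -inv; exists y.
have bwd (y : full_shift S) : subshift_set X y -> subshift_set X (shift (-1) y).
  by rewrite -{1}inv => -[z Xz <-]; rewrite shift_comp subrr shift0.
elim/int_rect: n => [|n IH|n IH] Xx; first by rewrite shift0.
  by rewrite intS addrC -shift_comp; apply: fwd; exact: IH.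
rewrite intS opprD -shift_comp.
by rewrite shift_comp addrC -shift_comp; apply: bwd; exact: IH.
Qed.

Definition subshift_act (n : int) (x : X) : X :=
  SigSub (mem_set (subshift_shift n (set_valP x))).

Lemma subshift_actE n (x : X) : set_val (subshift_act n x) = shift n (set_val x).
Proof. by []. Qed.

(** The quotient map from the suspension to the mapping torus is open, since it
    is the quotient by a group of homeomorphisms. Hence products of cylinders
    and intervals give a basis of neighbourhoods downstairs as well. *)
Lemma nbhs_torusP (x : X) (t : R) (V : set torus) :
  nbhs (torus_class x t) V <->
  exists m (e : R), 0 < e /\ forall (y : X) (s : R),
    agree m (set_val x) (set_val y) -> `|s - t| < e -> V (torus_class y s).
Proof.
split=> [nV|[m [e [e0 H]]]].
  have : nbhs (x, t) [set p : X * R | V (torus_class p.1 p.2)].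
    have := @pi_continuous (X * R)%type (mapping_torus R X) (x, t) V nV.
    by apply: (@filterS _ (nbhs (x, t))) => -[y s].
  move=> [[A B] /= [/nbhs_subshiftP[m HA] /nbhs_ballP[e e0 HB]] AB].
  exists m, e; split=> // y s xy st; apply: (AB (y, s)); split => /=.
    exact: HA.
  by apply: HB; rewrite /ball /= distrC.
pose W := [set z : torus | exists (y : X) (s : R) (m' : nat) (e' : R),
  [/\ z = torus_class y s, 0 < e' & forall y' s', agree m' (set_val y) (set_val y') ->
   `|s' - s| < e' -> V (torus_class y' s')]].
have oW : open W.
  rewrite /open /= /quotient_open.
  suff : open [set p : X * R | W (torus_class p.1 p.2)].
    suff -> : [set p : X * R | W (torus_class p.1 p.2)] = \pi_torus @^-1` W by [].
    by apply/seteqP; split => -[].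
  rewrite openE => -[y s] [y0 [s0 [m' [e' [/= E e'0 H']]]]].
  have [n [ny sn]] := (torus_classP _ _ _ _).1 E.
  exists ([set y' | agree (m' + `|n|) (set_val y) (set_val y')],
     [set s' | `|s' - s| < e' / 2]) => /=.
    split; first by apply/nbhs_subshiftP; exists (m' + `|n|)%N.
    apply/nbhs_ballP; exists (e' / 2); first by rewrite /= divr_gt0.
    by move=> s'; rewrite /ball /= distrC.
  move=> [y' s'] [/= ay as'].
  exists (subshift_act n y'), (s' - n%:~R), m', (e' / 2); split.
  - by rewrite (@torus_class_shift y').
  - by rewrite divr_gt0.
  - move=> y'' s'' a'' d''; apply: H'.
      rewrite ny; apply: agree_trans a''; rewrite subshift_actE => i im.
      by rewrite /shift; apply: ay; lia.
    have := ltrD as' d''; rewrite -splitr; apply: le_lt_trans.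
    apply: le_trans (ler_normD _ _).
    by rewrite sn le_eqVlt; apply/orP; left; apply/eqP; congr `|_|; lra.
suff : nbhs (torus_class x t) W.
  apply: filterS => z [y [s [m' [e' [-> e'0 H']]]]]; apply: H' => //.
  by rewrite subrr normr0.
by apply: open_nbhs_nbhs; split => //; exists x, t, m, e.
Qed.

Lemma torus_ind (P : torus -> Prop) :
  (forall x t, P (torus_class x t)) -> forall z, P z.
Proof. by move=> H z; rewrite -(torus_class_repr z); exact: H. Qed.

End CylinderTopology.

Section TorusPaths.
Variables (S : finType) (X : subshift S) (R : realType).
Local Notation torus := (mapping_torus R X).

Lemma int_close (a b : int) (r : R) :
  `|a%:~R - r| < 2^-1 -> `|b%:~R - r| < 2^-1 -> a = b.
Proof.
rewrite !ltr_norml => /andP[a1 a2] /andP[b1 b2].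
have h1 : (a - b)%:~R < (1%:~R : R) by rewrite intrB; lra.
have h2 : (b - a)%:~R < (1%:~R : R) by rewrite intrB; lra.
by move: h1 h2; rewrite !ltr_int; lia.
Qed.

(** If two points cannot be separated, then approximations of their
    representatives are related by shifts of nearly the same real length. The
    integer length is then constant, and the relation passes to the limit. *)
Lemma torus_hausdorff : hausdorff_space torus.
Proof.
elim/torus_ind => x t; elim/torus_ind => y s xy.
have close m (e : R) : 0 < e -> exists k : int, `|k%:~R - (t - s)| < e + e /\
    forall i : int, `|i| + `|k| <= m%:Z -> set_val y i = set_val x (i + k).
  move=> e0; pose U (x0 : X) (t0 : R) := [set z : torus | exists (x' : X) (t' : R),
    [/\ agree m (set_val x0) (set_val x'), `|t' - t0| < e & z = torus_class x' t']].
  have nU x0 t0 : nbhs (torus_class x0 t0) (U x0 t0).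
    by apply/nbhs_torusP; exists m, e; split => // x' t' ? ?; exists x', t'.
  have [z [[x' [t' [ax ht ->]]] [y' [s' [ay hs /torus_classP[k [yk sk]]]]]]] :=
    xy _ _ (nU x t) (nU y s).
  exists k; split.
    have := ltrD hs ht; apply: le_lt_trans; rewrite (distrC t').
    apply: le_trans (ler_normD _ _); rewrite distrC le_eqVlt; apply/orP; left.
    by apply/eqP; congr `|_|; lra.
  by move=> i ik; rewrite ay ?yk ?ax //; lia.
(* Below one quarter, the shift relating two approximations is always the same. *)
have q0 : 0 < 4^-1 :> R by rewrite invr_gt0.
have [k0 [hk0 _]] := close 0%N _ q0.
have same m (e : R) : 0 < e -> e <= 4^-1 -> `|k0%:~R - (t - s)| < e + e /\
    forall i : int, `|i| + `|k0| <= m%:Z -> set_val y i = set_val x (i + k0).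
  move=> e0 e4; have [k [hk kE]] := close m _ e0.
  suff -> : k0 = k by [].
  apply: (@int_close _ _ (t - s)).
    by apply: lt_le_trans hk0 _; lra.
  by apply: lt_le_trans hk _; lra.
apply/torus_classP; exists k0; split.
  apply/funext => i; have [_] := same (`|i| + `|k0|)%N _ q0 (lexx _).
  by apply; lia.
suff : k0%:~R - (t - s) == 0 by move/eqP; lra.
rewrite -normr_le0 leNgt; apply/negP => d0.
set d := `|_| in d0.
have [||] := same 0%N (Num.min (d / 2) 4^-1).
- by rewrite lt_min q0 divr_gt0.
- by rewrite ge_min lexx orbT.
rewrite -/d => + _; rewrite ltNge => /negP; apply.
have : Num.min (d / 2) 4^-1 <= d / 2 by rewrite ge_min lexx.
by rewrite -/d; lra.
Qed.

Lemma flowD (r s : R) (z : torus) : flow r (flow s z) = flow (s + r) z.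
Proof. by elim/torus_ind: z => x t; rewrite !flowE addrA. Qed.

Lemma flow0 (z : torus) : flow 0 z = z.
Proof. by elim/torus_ind: z => x t; rewrite flowE addr0. Qed.

Lemma window_class_inj (x y : X) (s t s0 : R) :
  `|s - s0| < 2^-1 -> `|t - s0| < 2^-1 ->
  torus_class x s = torus_class y t -> x = y.
Proof.
move=> hs ht /torus_classP[k [yk tk]]; have k0 : k = 0.
  apply: (@int_close _ _ (s - s0)).
    have -> : k%:~R - (s - s0) = - (t - s0) by rewrite tk; lra.
    by rewrite normrN.
  by rewrite sub0r normrN.
by apply: val_inj; move: yk; rewrite k0 shift0.
Qed.

(** A flow box of width one, cut along a clopen condition on one coordinate. *)
Definition window (s0 : R) (i : int) (P : pred S) : set torus :=
  [set z | exists (x : X) (s : R),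
    [/\ `|s - s0| < 2^-1, P (set_val x i) & z = torus_class x s]].

Lemma open_window s0 i P : open (window s0 i P).
Proof.
rewrite openE => _ [x [s [hs Px ->]]]; apply/nbhs_torusP.
exists `|i|%N, (2^-1 - `|s - s0|); split; first by rewrite subr_gt0.
move=> y s' a hs'; exists y, s'; split => //; last by rewrite -a //; lia.
have -> : s' - s0 = (s' - s) + (s - s0) by lra.
by apply: le_lt_trans (ler_normD _ _) _; rewrite -ltrBrDr.
Qed.

(** In a flow box the path has a continuous projection to the totally
    disconnected transversal, so on a small interval it moves only along the
    flow. *)
Lemma path_local_orbit (gamma : R -> torus) (t0 : R) :
  continuous gamma -> exists2 d : R, 0 < d &
  forall t, `|t - t0| < d -> exists r, gamma t = flow r (gamma t0).
Proof.
move=> gc; rewrite -(torus_class_repr (gamma t0)).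
move: (repr _).1 (repr _).2 (torus_class_repr (gamma t0)) => x0 s0 E0.
have nV : nbhs (gamma t0) (window s0 0 predT).
  apply: open_nbhs_nbhs; split; first exact: open_window.
  by exists x0, s0; split; rewrite // subrr normr0 invr_gt0.
have /nbhs_ballP[d d0 Hd] := gc t0 _ nV.
exists d => // t td.
have coord i : ball t0 d = ball t0 d `&` gamma @^-1` window s0 i (pred1 (set_val x0 i)).
  have /connected_intervalP conn : is_interval (ball t0 d).
    move=> a b; rewrite /ball /= => ta tb c.
    move: ta tb; rewrite !ltr_distlC => /andP[a1 a2] /andP[b1 b2] /andP[ac cb].
    by apply/andP; split; [exact: lt_le_trans ac|exact: le_lt_trans b2].
  apply/esym; apply: conn.
  - exists t0; split; first exact: ballxx.
    by exists x0, s0; split; rewrite /= ?subrr ?normr0 ?invr_gt0.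
  - exists (gamma @^-1` window s0 i (pred1 (set_val x0 i))) => //.
    by move/continuousP: gc; apply; exact: open_window.
  - exists (~` (gamma @^-1` window s0 i (predC1 (set_val x0 i)))).
      by apply: open_closedC; move/continuousP: gc; apply; exact: open_window.
    apply/seteqP; split => u [Bu] /=.
      move=> [x [s [hs /eqP xi E]]]; split => // -[y [s' [hs' /eqP yi]]].
      by rewrite E => /(window_class_inj hs hs') xy; apply: yi; rewrite -xy.
    move=> H; split => //; have [x [s [hs _ E]]] := Hd _ Bu.
    exists x, s; split => //=; apply/negPn/negP => xi.
    by apply: H; exists x, s.
have Bt : ball t0 d t by rewrite /ball /= distrC.
have [x [s [hs _ E]]] := Hd _ Bt.
have xx0 : x = x0.
  apply/val_inj/funext => i.
  have := Bt; rewrite (coord i) => -[_ [y [s' [hs' /eqP yi E']]]].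
  by move: E'; rewrite E => /(window_class_inj hs hs') ->.
by exists (s - s0); rewrite flowE E xx0; congr torus_class; lra.
Qed.

(** By the previous lemma the orbits cut the line into open sets. *)
Lemma path_orbit (gamma : R -> torus) :
  continuous gamma -> forall t, exists r, gamma t = flow r (gamma 0).
Proof.
move=> gc; pose O := [set t : R | exists r, gamma t = flow r (gamma 0)].
suff : O = setT by move=> OT t; have : O t by rewrite OT.
have /connected_intervalP conn : is_interval [set: R] by [].
have opn t0 d : 0 < d -> nbhs t0 [set t : R | `|t - t0| < d].
  by move=> d0; apply/nbhs_ballP; exists d => // t; rewrite /ball /= distrC.
apply: conn.
- by exists 0, 0; rewrite flow0.
- exists O; rewrite ?setTI // openE => t0 [r Er].
  have [d d0 H] := path_local_orbit t0 gc.
  apply: (@filterS _ (nbhs t0) _ _ _ _ (opn t0 d d0)) => t /H[r' E].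
  by exists (r + r'); rewrite E Er flowD.
- exists O; rewrite ?setTI //; rewrite -(setCK O); apply: open_closedC.
  rewrite openE => t0 nO; have [d d0 H] := path_local_orbit t0 gc.
  apply: (@filterS _ (nbhs t0) _ _ _ _ (opn t0 d d0)) => t /H[r' E] [r Er].
  apply: nO; exists (r - r'); rewrite -flowD -Er E flowD subrr flow0 //.
Qed.

Lemma isotopic_same_orbit (f g : torus_group R X) (z : torus) :
  isotopic f g -> exists r, g z = flow r (f z).
Proof.
move=> [h [hc h0 h1 _]].
pose clamp (t : R) := Num.min (Num.max t 0) 1.
have cc : continuous clamp.
  have cst (c : R) : continuous (fun _ : R => c : R^o) by move=> t; exact: cvg_cst.
  have cmax : continuous ((fun t : R => t : R^o) \max (fun=> 0)).
    by move=> t; exact: (continuous_max (@cvg_id _ _) (cst 0 t)).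
  by move=> t; exact: (continuous_min (cmax t) (cst 1 t)).
pose gamma (t : R) := h (clamp t, z).
have gc : continuous gamma.
  apply/continuous_subspace_setT.
  pose phi (t : R) : R * torus := (clamp t, z).
  suff : {within setT, continuous (h \o phi)} by [].
  have wc := @within_comp _ _ _ _ setT h phi hc.
  apply: wc.
    by apply: continuous_pair => // t; exact: cvg_cst.
  move=> t _ /=; split => //=; rewrite in_itv /= /clamp le_min ler01 andbT.
  by rewrite le_max lexx orbT ge_min lexx orbT.
have [r] := path_orbit gc 1.
rewrite /gamma /clamp.
have -> : Num.min (Num.max 1 0) 1 = 1 :> R by rewrite max_l ?ler01 // min_l.
have -> : Num.min (Num.max 0 0) 1 = 0 :> R by rewrite maxxx min_l ?ler01.
by rewrite h0 h1 => ->; exists r.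
Qed.
End TorusPaths.

(** * Maps of the mapping torus from lifts to the suspension *)

Section IncreasingBijections.
Variable R : realType.

Lemma incr_mono (f : R -> R) :
  {homo f : s t / s < t} -> {mono f : s t / s < t}.
Proof. by move=> fi; apply/leW_mono/le_mono. Qed.

Lemma incr_surj_continuous (f : R -> R) :
  {homo f : s t / s < t} -> (forall s, exists t, f t = s) -> continuous f.
Proof.
move=> fi fs t; apply/cvgrPdist_lt => e e0.
have fm := incr_mono fi.
have [a Ea] := fs (f t - e); have [b Eb] := fs (f t + e).
have at_ : a < t by rewrite -fm Ea; lra.
have tb : t < b by rewrite -fm Eb; lra.
apply/nbhs_ballP; exists (Num.min (t - a) (b - t)) => /=.
  by rewrite lt_min !subr_gt0 at_ tb.
move=> s; rewrite /ball /= lt_min !ltr_distlC => /andP[/andP[h1 h2] /andP[h3 h4]].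
have : f a < f s by rewrite fm; lra.
have : f s < f b by rewrite fm; lra.
by rewrite Ea Eb => ? ?; apply/andP; split; lra.
Qed.

Lemma incr_surj_homeomorphism (f : R -> R) :
  {homo f : s t / s < t} -> (forall s, exists t, f t = s) -> homeomorphism f.
Proof.
move=> fi fs; have fm := incr_mono fi.
have [g gK] := choice fs.
have fK : cancel f g by move=> t; apply: (inc_inj (le_mono fi)); rewrite gK.
exists g; split => //; first exact: incr_surj_continuous.
apply: incr_surj_continuous => [s t st|t]; last by exists (f t).
by rewrite -fm !gK.
Qed.

End IncreasingBijections.

Section LiftedMaps.
Variables (S : finType) (X : subshift S) (R : realType).
Local Notation torus := (mapping_torus R X).
Variables (F : X -> X) (N : X -> int -> int) (Phi : X -> R -> R).

(** A map of the suspension that descends to the mapping torus. Here [N x n] is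
    the length that the image of a path of length [n] from [x] acquires. Being
    an increasing bijection of the line, [Phi x] is continuous. *)
Record torus_lift : Prop := TorusLift {
  lift_shift : forall n x,
    set_val (F (subshift_act n x)) = shift (N x n) (set_val (F x));
  lift_time : forall n x t,
    Phi (subshift_act n x) t = Phi x (t + n%:~R) - (N x n)%:~R;
  lift_base_local : forall x m, exists k, forall y,
    agree k (set_val x) (set_val y) -> agree m (set_val (F x)) (set_val (F y));
  lift_time_local : forall x b, exists k, forall y,
    agree k (set_val x) (set_val y) -> forall t, `|t| <= b -> Phi y t = Phi x t;
  lift_time_incr : forall x, {homo Phi x : s t / s < t};
  lift_time_surj : forall x s, exists t, Phi x t = s }.

Hypothesis lifting : torus_lift.

Definition lift_map (z : torus) : torus :=
  torus_class (F (repr z).1) (Phi (repr z).1 (repr z).2).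

Lemma lift_mapE x t : lift_map (torus_class x t) = torus_class (F x) (Phi x t).
Proof.
have := torus_class_repr (torus_class x t); rewrite /lift_map.
move: (repr _) => [y s] /= /torus_classP[n [xy ts]].
apply/torus_classP; exists (N y n).
have -> : x = subshift_act n y by apply: val_inj.
by rewrite (lift_shift lifting) (lift_time lifting) ts subrK.
Qed.

Lemma lift_map_continuous : continuous lift_map.
Proof.
move=> z; rewrite -(torus_class_repr z); move: (repr z) => [x t] /= V.
rewrite lift_mapE => /nbhs_torusP[m [e [e0 HV]]].
have [k1 H1] := lift_base_local lifting x m.
have [k2 H2] := lift_time_local lifting x (`|t| + 1).
have := incr_surj_continuous (@lift_time_incr lifting x) (@lift_time_surj lifting x).
move=> /(_ t) /cvgrPdist_lt /(_ e e0) /nbhs_ballP[d /= d0 Hd].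
apply/nbhs_torusP; exists (maxn k1 k2), (Num.min d 1).
split; first by rewrite lt_min d0 ltr01.
move=> y s axy; rewrite lt_min => /andP[sd s1].
suff : V (lift_map (torus_class y s)) by [].
rewrite lift_mapE; apply: HV.
  by apply: H1; apply: agreeW axy; exact: leq_maxl.
rewrite H2; first by rewrite distrC; apply: Hd; rewrite /ball /= distrC.
  by apply: agreeW axy; exact: leq_maxr.
have -> : s = t + (s - t) by lra.
by apply: le_trans (ler_normD _ _) _; rewrite lerD2l ltW.
Qed.

Lemma lift_map_orientation : preserves_orientation lift_map.
Proof.
elim/torus_ind => x t; exists (fun r => Phi x (t + r) - Phi x t).
have incr : {homo (fun r => Phi x (t + r) - Phi x t) : s t / s < t}.
  by move=> a b ab; rewrite ltrD2r (lift_time_incr lifting) // ltrD2l.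
split=> //.
  apply: incr_surj_homeomorphism => // s.
  have [u uE] := lift_time_surj lifting x (s + Phi x t).
  by exists (u - t); rewrite (addrC t) subrK uE addrK.
by move=> r; rewrite flowE !lift_mapE flowE addrCA subrr addr0.
Qed.

End LiftedMaps.

(** As the mapping torus is Hausdorff, its continuous self-maps are determined
    by the fibres over a dense set of base points. *)
Lemma torus_dense_eq (S : finType) (X : subshift S) (R : realType)
    (D : set X) (f g : mapping_torus R X -> mapping_torus R X) :
  (forall (x : X) m, exists2 y, D y & agree m (set_val x) (set_val y)) ->
  continuous f -> continuous g ->
  (forall x t, D x -> f (torus_class x t) = g (torus_class x t)) -> f =1 g.
Proof.
move=> dD fc gc fg; elim/torus_ind => x t; apply: torus_hausdorff => A B nA nB.
have nAB : nbhs (torus_class x t) (f @^-1` A `&` g @^-1` B).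
  by apply: (@filterI _ (nbhs (torus_class x t))); [exact: fc|exact: gc].
have [m [e [e0 H]]] := (nbhs_torusP _ _ _).1 nAB.
have [y Dy xy] := dD x m.
have [|Af Bg] := H y t xy; first by rewrite subrr normr0.
by exists (f (torus_class y t)); split => //; rewrite fg.
Qed.

(** * A one-parameter group of homeomorphisms of the half-line *)

Section Slide.
Variable R : realFieldType.
Implicit Types (a b e s t : R).

(** [slow_time] is the time needed to reach [e] from [1] along the vector field
    with value [1] for [e >= 1] and [e ^+ 2] for [e <= 1], increased by [1]. It
    maps the open half-line onto the real line, and [slide a] is the translation
    by [a] in this coordinate. *)
Definition slow_time e := if 1 <= e then e else 2 - e^-1.
Definition slow_time_inv s := if 1 <= s then s else (2 - s)^-1.

Definition slide a e := if e <= 0 then e else slow_time_inv (slow_time e + a).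

Lemma slow_timeK e : 0 < e -> slow_time_inv (slow_time e) = e.
Proof.
move=> e0; rewrite /slow_time /slow_time_inv; case: (leP 1 e) => e1; first by rewrite e1.
rewrite ifN; first by rewrite opprB addrC subrK invrK.
by rewrite -ltNge ltrBlDr -ltrBlDl -[2]/(1 + 1) addrK invf_gt1.
Qed.

Lemma slow_time_invK s : slow_time (slow_time_inv s) = s.
Proof.
rewrite /slow_time /slow_time_inv; case: (leP 1 s) => s1; first by rewrite s1.
have s2 : 1 < 2 - s by lra.
rewrite ifN; first by rewrite invrK opprB addrC subrK.
by rewrite -ltNge invf_lt1 // (lt_trans ltr01 s2).
Qed.

Lemma slow_time_inv_gt0 s : 0 < slow_time_inv s.
Proof.
rewrite /slow_time_inv; case: (leP 1 s) => s1; first exact: lt_le_trans ltr01 s1.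
by rewrite invr_gt0; lra.
Qed.

Lemma slow_time_inv_incr : {homo slow_time_inv : s t / s < t}.
Proof.
move=> s t st; rewrite /slow_time_inv; case: (leP 1 s) => s1.
  by rewrite ifT // (le_trans s1) // ltW.
have s2 : 1 < 2 - s by lra.
case: (leP 1 t) => t1.
  by apply: lt_le_trans t1; rewrite invf_lt1 // (lt_trans ltr01 s2).
by rewrite ltf_pV2 ?posrE; lra.
Qed.

Lemma slow_time_incr e e' : 0 < e -> e < e' -> slow_time e < slow_time e'.
Proof.
move=> e0 ee'; have mono : {mono slow_time_inv : s t / s < t}.
  exact/leW_mono/le_mono/slow_time_inv_incr.
by rewrite -mono !slow_timeK // (lt_trans e0).
Qed.

Lemma slide0 e : slide 0 e = e.
Proof. by rewrite /slide; case: leP => // e0; rewrite addr0 slow_timeK. Qed.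

Lemma slide_le0 a e : e <= 0 -> slide a e = e.
Proof. by move=> e0; rewrite /slide e0. Qed.

Lemma slide_gt0 a e : 0 < e -> 0 < slide a e.
Proof. by move=> e0; rewrite /slide leNgt e0 slow_time_inv_gt0. Qed.

Lemma slide_ge0 a e : 0 <= e -> 0 <= slide a e.
Proof.
rewrite le_eqVlt => /orP[/eqP <-|/(slide_gt0 a)/ltW//].
by rewrite slide_le0.
Qed.

Lemma slideD a b e : slide b (slide a e) = slide (a + b) e.
Proof.
have [e0|e0] := leP e 0; first by rewrite !(slide_le0 _ e0).
rewrite {1}/slide leNgt slide_gt0 //= /slide leNgt e0 /=.
by rewrite slow_time_invK addrA.
Qed.

Lemma slide_incr a : {homo slide a : e e' / e < e'}.
Proof.
move=> e e' ee'; have [e0|e0] := leP e 0.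
  rewrite (slide_le0 a e0); have [e'0|e'0] := leP e' 0.
    by rewrite slide_le0.
  exact: le_lt_trans e0 (slide_gt0 a e'0).
rewrite /slide !leNgt e0 (lt_trans e0 ee') /=.
by apply: slow_time_inv_incr; rewrite ltrD2r slow_time_incr.
Qed.

Lemma slide_translation a e : 1 <= e -> 1 <= e + a -> slide a e = e + a.
Proof.
move=> e1 ea1; have e0 : 0 < e by exact: lt_le_trans ltr01 e1.
by rewrite /slide leNgt e0 /= /slow_time e1 /slow_time_inv ea1.
Qed.

(** The coordinate [slow_time] never exceeds [e]. *)
Lemma slide_le a e : 0 <= e -> slide a e <= Num.max 1 (e + a).
Proof.
move=> e0; rewrite /slide; case: (leP e 0) => e0'.
  by rewrite le_max (le_trans e0') // ler01.
have : slow_time e <= e.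
  rewrite /slow_time; case: (leP 1 e) => // e1.
  rewrite -subr_ge0; have -> : e - (2 - e^-1) = (e - 1) ^+ 2 * e^-1.
    by field; rewrite gt_eqF.
  by rewrite mulr_ge0 ?sqr_ge0 // invr_ge0.
rewrite /slow_time_inv le_max => h; case: (leP 1 (slow_time e + a)) => h1.
  by apply/orP; right; rewrite lerD2r.
by apply/orP; left; rewrite invf_le1; lra.
Qed.

(** Independent slides on the two sides of a centre placed at [0]. *)
Definition slide2 a b t := if t < 0 then - slide a (- t) else slide b t.

Lemma slide2_00 t : slide2 0 0 t = t.
Proof. by rewrite /slide2 !slide0 opprK; case: ifP. Qed.

Lemma slide2D a b a' b' t :
  slide2 a' b' (slide2 a b t) = slide2 (a + a') (b + b') t.
Proof.
rewrite {2 3}/slide2; case: ltP => t0.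
  rewrite /slide2 oppr_lt0 slide_gt0 ?oppr_gt0 //.
  by rewrite opprK slideD.
rewrite /slide2 ifN ?slideD // -leNgt; move: t0; rewrite le_eqVlt.
by case/orP => [/eqP <-|/(slide_gt0 b)/ltW//]; rewrite slide_le0.
Qed.

Lemma slide2_incr a b : {homo slide2 a b : s t / s < t}.
Proof.
move=> s t st; rewrite /slide2; case: (ltP s 0) => s0; last first.
  by rewrite ifN ?slide_incr // -leNgt (le_trans s0) // ltW.
case: (ltP t 0) => t0; first by rewrite ltrN2 slide_incr // ltrN2.
apply: (@lt_le_trans _ _ 0); first by rewrite oppr_lt0 slide_gt0 // oppr_gt0.
by move: t0; rewrite le_eqVlt => /orP[/eqP <-|/(slide_gt0 b)/ltW//]; rewrite slide_le0.
Qed.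

End Slide.

(** * Block codes *)

Section BlockCodes.
Variables (S : finType) (s0 : S) (w : full_shift S -> seq S).
Implicit Types (x y : full_shift S) (i j m : int).

(** The position in the image at which the block of index [i] begins. *)
Definition offset x i : int :=
  match i with
  | Posz n => (\sum_(k < n) size (w (shift k%:Z x)))%N%:Z
  | Negz n => - (\sum_(k < n.+1) size (w (shift (Negz k) x)))%N%:Z
  end.

Lemma offset0 x : offset x 0 = 0.
Proof. by rewrite -[0]/(Posz 0) /offset big_ord0. Qed.

Lemma offsetS x i : offset x (i + 1) = offset x i + (size (w (shift i x)))%:Z.
Proof.
case: i => [n|[|n]].
- have -> : n%:Z + 1 = n.+1 by lia.
  by rewrite /offset big_ord_recr /= PoszD.
- have -> : Negz 0 + 1 = 0 by [].
  by rewrite offset0 /offset big_ord_recr big_ord0 /= add0n addNr.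
- have -> : Negz n.+1 + 1 = Negz n by lia.
  rewrite /offset [in RHS]big_ord_recr /= PoszD; lia.
Qed.

Lemma int_ind2 (P : int -> Prop) :
  P 0 -> (forall i, P i -> P (i + 1)) -> (forall i, P (i + 1) -> P i) ->
  forall i, P i.
Proof.
move=> P0 up dn; elim/int_rect => // n Pn.
  have -> : n.+1%:Z = n%:Z + 1 by lia.
  by exact: up.
by apply: dn; have -> : - n.+1%:Z + 1 = - n%:Z by lia.
Qed.

Lemma offsetD x i j : offset x (i + j) = offset x i + offset (shift i x) j.
Proof.
elim/int_ind2: j => [|j IH|j].
- by rewrite addr0 offset0 addr0.
- by rewrite addrA !offsetS IH shift_comp addrA.
- by rewrite addrA !offsetS shift_comp addrA => /addIr.
Qed.

Lemma offset_le x i j : i <= j -> offset x i <= offset x j.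
Proof.
move=> ij; have -> : j = i + `|j - i|%N%:Z by lia.
elim: `|j - i|%N => [|n]; first by rewrite addr0.
have -> : i + n.+1 = (i + n) + 1 by lia.
by rewrite offsetS; lia.
Qed.

Lemma offset_segment x i (r : nat) : offset x (i + r%:Z) =
  offset x i + (size (flatten [seq w (shift (i + k%:Z) x) | k <- iota 0 r]))%:Z.
Proof.
elim: r => [|r IH]; first by rewrite !addr0.
have -> : i + r.+1 = (i + r) + 1 by lia.
rewrite offsetS IH -addn1 iotaD map_cat flatten_cat size_cat /= cats0 add0n; lia.
Qed.

(** Blocks may be empty. This condition ensures that infinitely many of them
    are not, in both directions. *)
Definition grows x := exists r : nat, forall i, offset x i < offset x (i + r%:Z).

Lemma grows_lower x j : grows x -> exists i, offset x i <= j.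
Proof.
move=> [r H]; have step (n : nat) : offset x (- (n * r)%N%:Z) <= - n%:Z.
  elim: n => [|n IH]; first by rewrite offset0.
  have := H (- (n.+1 * r)%N%:Z).
  have -> : - (n.+1 * r)%N%:Z + r = - (n * r)%N%:Z by lia.
  by lia.
by exists (- (`|j|%N * r)%N%:Z); have := step `|j|%N; lia.
Qed.

Lemma grows_upper x j : grows x -> exists i, j < offset x i.
Proof.
move=> [r H]; have step (n : nat) : n%:Z <= offset x (n * r)%N%:Z.
  elim: n => [|n IH]; first by rewrite offset0.
  have := H (n * r)%N%:Z.
  have -> : (n * r)%N%:Z + r = (n.+1 * r)%N%:Z by lia.
  by lia.
by exists ((`|j|.+1 * r)%N%:Z); have := step `|j|.+1; lia.
Qed.

Lemma block_exists x j : grows x ->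
  exists i, offset x i <= j < offset x (i + 1).
Proof.
move=> gx; have [a ha] := grows_lower j gx; have [b hb] := grows_upper j gx.
have : exists n : nat, j < offset x (a + n%:Z).
  exists `|b - a|%N; apply: lt_le_trans hb _; apply: offset_le; lia.
move=> /[dup] ex; move: (ex_minnP ex) => [[|n] hn minn _].
  by rewrite addr0 in hn; lia.
exists (a + n%:Z); apply/andP; split; last first.
  by have -> : a + n%:Z + 1 = a + n.+1%:Z by lia.
by rewrite leNgt; apply/negP => /minn; rewrite ltnn.
Qed.

(** The concatenation of the words [w (shift i x)], where the block of index [0]
    begins at position [0]. *)
Definition block_code x : full_shift S := fun j =>
  let i := xget 0 [set i | offset x i <= j < offset x (i + 1)] in
  nth s0 (w (shift i x)) `|j - offset x i|%N.

Lemma block_codeE x i j : offset x i <= j < offset x (i + 1) ->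
  block_code x j = nth s0 (w (shift i x)) `|j - offset x i|%N.
Proof.
move=> ij; rewrite /block_code; case: xgetP => [i' _ i'j|/(_ i)//].
suff -> : i' = i by [].
have [lt|lt|//] := ltgtP i i'.
  have h : i + 1 <= i' by lia.
  move: i'j ij => /andP[a _] /andP[_ b].
  by have := lt_le_trans b (le_trans (offset_le x h) a); rewrite ltxx.
have h : i' + 1 <= i by lia.
move: i'j ij => /andP[_ b] /andP[a _].
by have := lt_le_trans b (le_trans (offset_le x h) a); rewrite ltxx.
Qed.

Lemma block_code_shift x m : grows x ->
  block_code (shift m x) = shift (offset x m) (block_code x).
Proof.
move=> gx; apply/funext => j; rewrite {2}/shift.
have [i hi] := block_exists (j + offset x m) gx.
have E1 : m + (i - m) = i by lia.
have E2 : m + (i - m + 1) = i + 1 by lia.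
have e1 := offsetD x m (i - m); have e2 := offsetD x m (i - m + 1).
rewrite E1 in e1; rewrite E2 in e2.
rewrite (block_codeE hi) (@block_codeE (shift m x) (i - m)).
  by rewrite shift_comp E1 e1; congr nth; congr absz; lia.
by move: hi; rewrite e1 e2; lia.
Qed.

Lemma block_code_segment x i (r : nat) (s : seq S) (k : nat) :
  flatten [seq w (shift (i + l%:Z) x) | l <- iota 0 r] = s -> (k < size s)%N ->
  block_code x (offset x i + k%:Z) = nth s0 s k.
Proof.
move=> <-; elim: r => [//|r IH].
rewrite -(addn1 r) iotaD map_cat flatten_cat size_cat nth_cat /= cats0 add0n.
move=> hk2; case: ltnP => hk; first exact: IH.
have seg := offset_segment x i r.
rewrite (@block_codeE x (i + r)); first by congr nth; lia.
by rewrite offsetS; lia.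
Qed.

Section Locality.
Variable rad : nat.
Hypothesis w_local : forall x y, agree rad x y -> w x = w y.

Lemma agree_shift (S' : Type) (k l : nat) (m : int) (x y : int -> S') :
  (k + `|m| <= l)%N -> agree l x y ->
  agree k (fun i => x (i + m)) (fun i => y (i + m)).
Proof. by move=> kl xy i ik; apply: xy; lia. Qed.

Lemma offset_local x y i : agree (rad + `|i|) x y -> offset x i = offset y i.
Proof.
have wE m : (`|m| <= `|i|)%N -> agree (rad + `|i|) x y ->
    size (w (shift m x)) = size (w (shift m y)).
  by move=> mi xy; congr size; apply: w_local; apply: agree_shift xy; lia.
case: i wE => n wE xy; rewrite /offset; [congr Posz|congr (- Posz _)];
  by apply: eq_bigr => k _; apply: wE => //; have := ltn_ord k; lia.
Qed.

Lemma block_code_local x (m : nat) : grows x ->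
  exists k, forall y, agree k x y -> agree m (block_code x) (block_code y).
Proof.
move=> gx.
have pt j : exists k, forall y, agree k x y -> block_code x j = block_code y j.
  have [i hi] := block_exists j gx; exists (rad + `|i| + 1)%N => y xy.
  have e1 : offset x i = offset y i by apply: offset_local; apply: agreeW xy; lia.
  have e2 : offset x (i + 1) = offset y (i + 1).
    by apply: offset_local; apply: agreeW xy; lia.
  rewrite (block_codeE hi) (@block_codeE y i) -?e1 -?e2 //.
  by congr nth; apply: w_local; apply: agree_shift xy; lia.
elim: m => [|m [k Hk]].
  have [k Hk] := pt 0; exists k => y xy j j0; have -> : j = 0 by lia.
  exact: Hk.
have [k1 H1] := pt m.+1%:Z; have [k2 H2] := pt (- m.+1%:Z).
exists (maxn k (maxn k1 k2)) => y xy j jm.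
have [jm'|jm'] := leP `|j| m%:Z; first by apply: Hk => //; apply: agreeW xy; lia.
have [j0|j0] := leP 0 j.
  have -> : j = m.+1 by lia.
  by apply: H1; apply: agreeW xy; lia.
have -> : j = - m.+1%:Z by lia.
by apply: H2; apply: agreeW xy; lia.
Qed.

End Locality.

End BlockCodes.

(** * The vertex shift and its cells *)

Definition rows : seq (seq nat) :=
  [:: [:: 1; 1; 1; 0; 0; 0];
      [:: 1; 1; 1; 0; 0; 0];
      [:: 0; 0; 0; 1; 1; 1];
      [:: 0; 0; 0; 1; 1; 0];
      [:: 0; 0; 0; 1; 1; 1];
      [:: 0; 1; 1; 0; 0; 0]]%N.

Definition X0 : subshift 'I_6 := vertex_shift (matrix_of_rows 6 rows).

(** [s0] and [s1] write the binary digits on the left of a centre, [s3] and [s4]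
    those on its right; [s2] is the centre and [s5] the marker. *)
Definition s0 : 'I_6 := @Ordinal 6 0 isT.
Definition s1 : 'I_6 := @Ordinal 6 1 isT.
Definition s2 : 'I_6 := @Ordinal 6 2 isT.
Definition s3 : 'I_6 := @Ordinal 6 3 isT.
Definition s4 : 'I_6 := @Ordinal 6 4 isT.
Definition s5 : 'I_6 := @Ordinal 6 5 isT.

Lemma sym_case (P : 'I_6 -> Prop) :
  P s0 -> P s1 -> P s2 -> P s3 -> P s4 -> P s5 -> forall a, P a.
Proof.
by move=> p0 p1 p2 p3 p4 p5 [[|[|[|[|[|[|k]]]]]] lt //];
  rewrite (bool_irrelevance lt isT).
Qed.

Definition step (a b : 'I_6) : bool := nth 0%N (nth [::] rows a) b == 1%N.

Lemma X0P (x : full_shift 'I_6) :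
  subshift_set X0 x <-> forall i : int, step (x i) (x (i + 1)).
Proof.
split=> H i; first by have := H i; rewrite /matrix_of_rows mxE /step => ->.
by have := H i; rewrite /matrix_of_rows mxE /step => /eqP.
Qed.

Definition lbit (a : 'I_6) : option bool :=
  if a == s0 then Some false else if a == s1 then Some true else None.
Definition rbit (a : 'I_6) : option bool :=
  if a == s3 then Some false else if a == s4 then Some true else None.
Definition lsym (b : bool) : 'I_6 := if b then s1 else s0.
Definition rsym (b : bool) : 'I_6 := if b then s4 else s3.

Lemma lsymK : pcancel lsym lbit. Proof. by case. Qed.
Lemma rsymK : pcancel rsym rbit. Proof. by case. Qed.

(** These symbols can only be followed by digits of the left tape up to the
    centre, the other ones by digits of the right tape up to the marker. *)
Definition before_centre (a : 'I_6) : bool := [|| a == s0, a == s1 | a == s5].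

Lemma step_before a b : step a b -> before_centre a ->
  [|| b == s0, b == s1 | b == s2].
Proof. by elim/sym_case: a; elim/sym_case: b. Qed.

Lemma step_after a b : step a b -> ~~ before_centre a ->
  [|| b == s3, b == s4 | b == s5].
Proof. by elim/sym_case: a; elim/sym_case: b. Qed.

(** ** Density of the points with markers in both directions *)

Definition recurrent (x : full_shift 'I_6) : Prop :=
  forall i : int, (exists2 j : int, i <= j & x j = s5) /\ (exists2 j : int, j <= i & x j = s5).

(** Iterating [next_sym] or [prev_sym] leads from any symbol to the alternation
    of [s2] and [s5], that is, to empty cells. *)
Definition next_sym (a : 'I_6) : 'I_6 :=
  nth s5 [:: s2; s2; s5; s4; s5; s2] a.
Definition prev_sym (a : 'I_6) : 'I_6 :=
  nth s5 [:: s1; s5; s5; s2; s2; s2] a.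

Lemma step_next a : step a (next_sym a).
Proof. by elim/sym_case: a. Qed.

Lemma step_prev a : step (prev_sym a) a.
Proof. by elim/sym_case: a. Qed.

Lemma iter_next_s5 a (k : nat) : exists2 j : nat, (k <= j)%N & iter j next_sym a = s5.
Proof.
move: (iterD) => iD; suff [j jE] : exists j, iter j next_sym (iter k next_sym a) = s5.
  by exists (j + k)%N; rewrite ?leq_addl // iD.
elim/sym_case: (iter k next_sym a);
  by [exists 2%N|exists 1%N|exists 0%N].
Qed.

Lemma iter_prev_s5 a (k : nat) : exists2 j : nat, (k <= j)%N & iter j prev_sym a = s5.
Proof.
move: (iterD) => iD; suff [j jE] : exists j, iter j prev_sym (iter k prev_sym a) = s5.
  by exists (j + k)%N; rewrite ?leq_addl // iD.
elim/sym_case: (iter k prev_sym a);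
  by [exists 2%N|exists 1%N|exists 0%N].
Qed.

(** Outside the window the point is continued by empty cells. *)
Lemma recurrent_dense (x : full_shift 'I_6) (m : nat) : subshift_set X0 x ->
  exists y, [/\ subshift_set X0 y, recurrent y & agree m x y].
Proof.
move=> /X0P Xx.
pose y : full_shift 'I_6 := fun i =>
  if m%:Z < i then iter `|i - m%:Z|%N next_sym (x m%:Z)
  else if i < - m%:Z then iter `|- m%:Z - i|%N prev_sym (x (- m%:Z)) else x i.
have yR (j : nat) : y (m%:Z + j%:Z) = iter j next_sym (x m%:Z).
  rewrite /y; case: ltP => h; first by congr iter; lia.
  have j0 : j = 0%N by lia.
  by rewrite ifN ?j0 ?addr0 //; lia.
have yL (j : nat) : y (- m%:Z - j%:Z) = iter j prev_sym (x (- m%:Z)).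
  rewrite /y ifN; last by lia.
  case: ltP => h; first by congr iter; lia.
  have j0 : j = 0%N by lia.
  by rewrite j0 subr0.
have yM i : `|i| <= m%:Z -> y i = x i.
  by move=> im; rewrite /y ifN ?ifN //; lia.
exists y; split.
- apply/X0P => i; have [h|h] := leP m%:Z i.
    have -> : i = m%:Z + `|i - m%:Z|%N%:Z by lia.
    have -> : m%:Z + `|i - m%:Z|%N%:Z + 1 = m%:Z + `|i - m%:Z|.+1%:Z by lia.
    by rewrite !yR iterS step_next.
  have [h'|h'] := leP (- m%:Z) i; first by rewrite !yM //; lia.
  have [k ik] : exists k : nat, i = - m%:Z - k.+1%:Z.
    by exists (absz (- m%:Z - i - 1)%R); lia.
  have -> : i + 1 = - m%:Z - k%:Z by lia.
  rewrite ik.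
  by rewrite !yL iterS step_prev.
- move=> i; split.
    have [j jk jE] := iter_next_s5 (x m%:Z) `|i|.
    by exists (m%:Z + j%:Z); [lia|rewrite yR].
  have [j jk jE] := iter_prev_s5 (x (- m%:Z)) `|i|.
  by exists (- m%:Z - j%:Z); [lia|rewrite yL].
- by move=> i im; rewrite yM.
Qed.

Lemma recurrent_shift i x : recurrent x -> recurrent (shift i x).
Proof.
move=> rx j; have [[a ja xa] [b jb xb]] := rx (j + i); split.
  by exists (a - i); rewrite /shift ?subrK //; lia.
by exists (b - i); rewrite /shift ?subrK //; lia.
Qed.

(** ** Trimmed words *)

(** The default value makes the empty word trimmed. *)
Definition trimmed (s : seq bool) : bool := last true s.

Fixpoint trim (s : seq bool) : seq bool :=
  if s is b :: s' then
    if nilp (trim s') && ~~ b then [::] else b :: trim s'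
  else [::].

Lemma nth_trim s k : nth false (trim s) k = nth false s k.
Proof.
elim: s k => [|b s IH] [|k] //=; case: ifP => //.
- by case/andP => _ /negbTE ->.
- by case/andP => /nilP t0 _; rewrite -IH t0 ?nth_nil.
- by move=> _; exact: IH.
Qed.

Lemma trim_trimmed s : trimmed (trim s).
Proof.
rewrite /trimmed; elim: s => [|b s IH] //=; case: ifP => //= /negbT.
case: (trim s) IH => [|c t] //=.
by rewrite negbK.
Qed.

Lemma nth_inj_trimmed s t : trimmed s -> trimmed t ->
  nth false s =1 nth false t -> s = t.
Proof.
have le a b : trimmed a -> nth false a =1 nth false b -> (size a <= size b)%N.
  case: a => // c a; rewrite /trimmed -nth_last /= => la H.
  rewrite ltnNge; apply/negP => ba.
  have := H (size a); rewrite (@nth_default _ false b) // => E.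
  by move: la; rewrite (set_nth_default false) //= E.
move=> ts tt H; apply: (@eq_from_nth _ false) => [|i _]; last exact: H.
by apply/eqP; rewrite eqn_leq !le // => i; rewrite H.
Qed.

Lemma trim_id s : trimmed s -> trim s = s.
Proof. by move=> ts; apply: nth_inj_trimmed (trim_trimmed s) ts (nth_trim s). Qed.

Lemma trimmed_cat_drop s t (m : nat) : (m < size t)%N -> trimmed t ->
  trimmed (s ++ drop m t).
Proof.
rewrite /trimmed last_cat => mt; rewrite -{1}(cat_take_drop m t) last_cat.
by have := size_drop m t; case: (drop m t) => [/=|//]; lia.
Qed.

(** ** Cells *)

(** The tapes are read away from the centre, so the left one appears reversed. *)
Definition cellword (L R : seq bool) : seq 'I_6 :=
  s5 :: rev (map lsym L) ++ s2 :: map rsym R.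

(** The default symbol [s5] closes the cell. *)
Definition cell (L R : seq bool) (x : full_shift 'I_6) : Prop :=
  forall k : nat, (k <= size (cellword L R))%N -> x k%:Z = nth s5 (cellword L R) k.

Lemma size_cellword L R : size (cellword L R) = (size L + size R).+2.
Proof. by rewrite /= size_cat /= size_rev !size_map addnS. Qed.

Section CellSymbols.
Variables (L R : seq bool) (x : full_shift 'I_6).
Hypothesis cx : cell L R x.

Lemma cell_first : x 0 = s5.
Proof. exact: (@cx 0%N). Qed.

Lemma cell_last : x (size (cellword L R))%:Z = s5.
Proof. by rewrite cx // nth_default. Qed.

Lemma cell_centre : x (size L).+1%:Z = s2.
Proof.
rewrite cx; last by rewrite size_cellword; lia.
by rewrite /= nth_cat size_rev size_map ltnn subnn.
Qed.

Lemma cell_left k : (k < size L)%N ->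
  x ((size L).+1%:Z - k.+1%:Z) = lsym (nth false L k).
Proof.
move=> kL; have -> : (size L).+1%:Z - k.+1%:Z = (size L - k.+1).+1%:Z by lia.
rewrite cx; last by rewrite size_cellword; lia.
rewrite /= nth_cat size_rev size_map ifT; last by lia.
rewrite nth_rev ?size_map; last by lia.
rewrite (nth_map false); last by lia.
by congr (lsym (nth _ _ _)); lia.
Qed.

Lemma cell_right k : (k < size R)%N ->
  x ((size L).+1%:Z + k.+1%:Z) = rsym (nth false R k).
Proof.
move=> kR; have -> : (size L).+1%:Z + k.+1%:Z = (size L + k.+1).+1%:Z by lia.
rewrite cx; last by rewrite size_cellword; lia.
rewrite /= nth_cat size_rev size_map ifN; last by lia.
by rewrite addKn /= (nth_map false).
Qed.

End CellSymbols.

Lemma cell_step L R x k : trimmed L -> trimmed R -> cell L R x ->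
  (k < size (cellword L R))%N -> step (x k%:Z) (x k.+1%:Z).
Proof.
move=> tL tR cx; rewrite size_cellword => kd.
have [->|k0] := eqVneq k 0%N.
  rewrite (cell_first cx); have [L0|Lpos] := posnP (size L).
    by have := cell_centre cx; rewrite L0 => ->.
  have h : ((size L).-1 < size L)%N by lia.
  have := cell_left cx h; have -> : (size L).+1%:Z - (size L).-1.+1%:Z = 1 by lia.
  move=> ->; suff -> : nth false L (size L).-1 = true by [].
  by move: tL; rewrite /trimmed -nth_last (set_nth_default false) //.
have [kL|kL] := ltnP k (size L).+1.
  have h : (size L - k < size L)%N by lia.
  have := cell_left cx h; have -> : (size L).+1%:Z - (size L - k).+1%:Z = k by lia.
  move=> ->; have [kL'|kL'] := ltnP k (size L).
    have h' : (size L - k.+1 < size L)%N by lia.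
    have := cell_left cx h'; have -> : (size L).+1%:Z - (size L - k.+1).+1%:Z = k.+1 by lia.
    by move=> ->; do 2 case: (nth _ _ _).
  have -> : k = size L by lia.
  by rewrite (cell_centre cx); case: nth.
have [->|kL1] := eqVneq k (size L).+1.
  rewrite (cell_centre cx); have [R0|Rpos] := posnP (size R).
    by have := cell_last cx; rewrite size_cellword R0 addn0 => ->.
  have := cell_right cx Rpos; have -> : (size L).+1%:Z + 1%:Z = (size L).+2 by lia.
  by move=> ->; case: nth.
have h : (k - (size L).+2 < size R)%N by lia.
have := cell_right cx h; have -> : (size L).+1%:Z + (k - (size L).+2).+1%:Z = k by lia.
move=> ->; have [kR|kR] := ltnP (k - (size L).+1) (size R).
  have := cell_right cx kR; have -> : (size L).+1%:Z + (k - (size L).+1).+1%:Z = k.+1 by lia.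
  by move=> ->; do 2 case: (nth _ _ _).
have -> : k.+1 = size (cellword L R) by rewrite size_cellword; lia.
rewrite (cell_last cx).
have -> : (k - (size L).+2 = (size R).-1)%N by lia.
suff -> : nth false R (size R).-1 = true by [].
by move: tR; rewrite /trimmed -nth_last (set_nth_default false) //; lia.
Qed.

Lemma find_first (P : pred int) (i j : int) : i <= j -> P j ->
  exists2 k : int, i <= k <= j & P k /\ forall l, i <= l < k -> ~~ P l.
Proof.
move=> ij Pj; have ex : exists n : nat, P (i + n%:Z).
  by exists `|j - i|%N; have -> : i + `|j - i|%N%:Z = j by lia.
case: (ex_minnP ex) => n Pn minn; exists (i + n%:Z).
  apply/andP; split; first by lia.
  have := minn `|j - i|%N; have -> : i + `|j - i|%N%:Z = j by lia.
  by move=> /(_ Pj); lia.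
split=> // l hl; apply/negP => Pl; have := minn `|l - i|%N.
have -> : i + `|l - i|%N%:Z = l by lia.
by move=> /(_ Pl); lia.
Qed.

Lemma cell_intro L R x : x 0 = s5 -> x (size L).+1%:Z = s2 ->
  x (size L + size R).+2%:Z = s5 ->
  (forall k, (k < size L)%N -> x ((size L).+1%:Z - k.+1%:Z) = lsym (nth false L k)) ->
  (forall k, (k < size R)%N -> x ((size L).+1%:Z + k.+1%:Z) = rsym (nth false R k)) ->
  cell L R x.
Proof.
move=> x0 x2 x5 xL xR [|k]; rewrite size_cellword => kd; first by rewrite x0.
rewrite /= nth_cat size_rev size_map; case: ltnP => kL.
  rewrite nth_rev ?size_map // (nth_map false); last by lia.
  by rewrite -xL; [congr x|]; lia.
case: (k - size L)%N (subnKC kL) => [|j] kE; first by rewrite -kE addn0 x2.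
have [jR|jR] := ltnP j (size R).
  by rewrite /= (nth_map false) // -xR //; congr x; lia.
by rewrite /= nth_default ?size_map // -x5; congr x; lia.
Qed.

(** From a marker, the first symbol that is not a digit of the left tape is a
    centre, and after it the first symbol that is not a digit of the right tape
    is a marker. *)
Lemma cell_exists x : subshift_set X0 x -> recurrent x -> x 0 = s5 ->
  exists L R, [/\ trimmed L, trimmed R & cell L R x].
Proof.
move=> /X0P Xx rx x0.
have [[j j1 xj] _] := rx 1.
have [|e /andP[e1 _] [xe xl]] := @find_first (fun l => lbit (x l) == None) 1 j j1.
  by rewrite xj.
have {xe} x2 : x e = s2.
  have := Xx (e - 1); rewrite subrK => /step_before.
  have pe : before_centre (x (e - 1)).
    have [->|ne] := eqVneq e 1; first by rewrite subrr x0.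
    have h : 1 <= e - 1 < e by lia.
    by have := xl _ h; elim/sym_case: (x (e - 1)).
  by move=> /(_ pe); move: xe; elim/sym_case: (x e).
have [[j' j'1 xj'] _] := rx (e + 1).
have [|d /andP[d1 _] [xd xr]] := @find_first (fun l => rbit (x l) == None) (e + 1) j' j'1.
  by rewrite xj'.
have nd : x (d - 1) = s2 /\ d = e + 1 \/ rbit (x (d - 1)) != None /\ d != e + 1.
  have [->|ne] := eqVneq d (e + 1); first by left; rewrite addrK.
  by right; split=> //; apply: xr; lia.
have sd := Xx (d - 1); rewrite subrK in sd.
have {xd} x5 : x d = s5.
  have := step_after sd; have pd : ~~ before_centre (x (d - 1)).
    by case: nd => [[-> _]|[+ _]] //; elim/sym_case: (x (d - 1)).
  by move=> /(_ pd); move: xd; elim/sym_case: (x d).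
have [a ea] : exists a : nat, e = a.+1%:Z by exists (absz (e - 1)%R); lia.
have [b db] : exists b : nat, d = a.+1%:Z + b.+1%:Z by exists (absz (d - e - 1)%R); lia.
pose L := mkseq (fun k => x (e - k.+1%:Z) == s1) a.
pose R := mkseq (fun k => x (e + k.+1%:Z) == s4) b.
have sL : size L = a by rewrite size_mkseq.
have sR : size R = b by rewrite size_mkseq.
exists L, R; split.
- rewrite /trimmed; case: (posnP a) => [a0|apos]; first by rewrite /L a0.
  rewrite -nth_last (set_nth_default false) sL ?nth_mkseq; try lia.
  have -> : e - a.-1.+1%:Z = 1 by lia.
  have h : (1 : int) <= 1 < e by rewrite lexx ea; lia.
  by have := Xx 0; have := xl _ h; rewrite add0r x0; elim/sym_case: (x 1).
- rewrite /trimmed; case: (posnP b) => [b0|bpos]; first by rewrite /R b0.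
  rewrite -nth_last (set_nth_default false) sR ?nth_mkseq; try lia.
  have -> : e + b.-1.+1%:Z = d - 1 by lia.
  case: nd => [[_ de]|[nb _]]; first by lia.
  by move: nb sd; rewrite x5; elim/sym_case: (x (d - 1)).
- apply: cell_intro; rewrite ?sL ?sR //; first by rewrite -ea.
  + by rewrite -x5 db; congr x; lia.
  + move=> k ka; rewrite nth_mkseq // -ea.
    have h : 1 <= e - k.+1%:Z < e by lia.
    by have := xl _ h; elim/sym_case: (x (e - _)).
  + move=> k kb; rewrite nth_mkseq // -ea.
    have h : e + 1 <= e + k.+1%:Z < d by lia.
    by have := xr _ h; elim/sym_case: (x (e + _)).
Qed.


(** The cells of a recurrent point cover the line. The scale [nu] is the identity
    when positions in [x] are meant, and [offset] when positions in the image of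
    [x] under a code are meant. *)
Lemma cell_cover (disp : Order.disp_t) (T : orderType disp) x (nu : int -> T) (t : T) :
  subshift_set X0 x -> recurrent x -> (forall i j, i <= j -> (nu i <= nu j)%O) ->
  (exists i, (nu i <= t)%O) -> (exists i, (t < nu i)%O) ->
  exists (i : int) L M, [/\ x i = s5, trimmed L, trimmed M, cell L M (shift i x) &
    (nu i <= t < nu (i + (size (cellword L M))%:Z)%R)%O].
Proof.
move=> Xx rx nuh [a ha] [b hb].
have {a ha} [a [xa ha]] : exists a, x a = s5 /\ (nu a <= t)%O.
  have [_ [a' a'a xa']] := rx a; exists a'; split=> //.
  exact: le_trans (nuh _ _ a'a) ha.
have [n nE] : exists n : nat, n%:Z = `|b - a| by exists `|b - a|%N; lia.
elim/ltn_ind: n a xa ha nE => n IH a xa ha nE.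
have ra := recurrent_shift a rx; have Xa := subshift_shift a Xx.
have [|L [M [tL tM cx]]] := cell_exists Xa ra; first by rewrite /shift add0r.
set d := size (cellword L M).
have d0 : (0 < d)%N by [].
have [h|h] := leP (nu (a + d%:Z)) t; last by exists a, L, M; rewrite ha h.
have ab : a + d%:Z < b.
  by rewrite ltNge; apply/negP => /nuh h'; move: (lt_le_trans hb h'); rewrite ltNge h.
have xd : x (a + d%:Z) = s5.
  by have := cell_last cx; rewrite /shift => <-; congr x; rewrite /d; lia.
have lt : (absz (b - (a + d%:Z))%R < n)%N by lia.
by apply: (IH _ lt _ xd h); lia.
Qed.

(** * The block code of an element of 2V *)

Lemma find_iota (P : pred nat) (m k : nat) : (k < m)%N -> P k ->
  (forall j, (j < k)%N -> ~~ P j) -> find P (iota 0 m) = k.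
Proof.
move=> km Pk nP; have -> : m = (k + (m - k).-1.+1)%N by lia.
rewrite iotaD find_cat size_iota add0n /= Pk addn0 ifN //.
by apply/hasPn => j; rewrite mem_iota => jk; apply: nP; lia.
Qed.

Lemma find_iota_none (P : pred nat) (m : nat) :
  (forall j, (j < m)%N -> ~~ P j) -> find P (iota 0 m) = m.
Proof.
move=> nP; rewrite hasNfind ?size_iota //.
by apply/hasPn => j; rewrite mem_iota => jk; apply: nP; lia.
Qed.

Lemma flatten_iota_drop (T : Type) (f : nat -> seq T) (a : nat -> T) (m r : nat) :
  (forall k, (k < r)%N -> f k = if (k < m)%N then [::] else [:: a k]) ->
  flatten [seq f k | k <- iota 0 r] = [seq a k | k <- iota m (r - m)].
Proof.
elim: r => [|r IH] H; first by rewrite sub0n.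
rewrite -addn1 iotaD map_cat flatten_cat IH /= => [|k kr]; last by apply: H; lia.
rewrite add0n H ?addn1 //; case: ltnP => mr.
  have -> : (r - m = r.+1 - m)%N by lia.
  by rewrite !cats0.
have -> : (r.+1 - m = (r - m) + 1)%N by lia.
by rewrite iotaD map_cat /= subnKC.
Qed.

Lemma flatten_iota_take (T : Type) (f : nat -> seq T) (a : nat -> T) (m r : nat) :
  (forall k, (k < r)%N -> f k = if (k < m)%N then [:: a k] else [::]) ->
  flatten [seq f k | k <- iota 0 r] = [seq a k | k <- iota 0 (minn m r)].
Proof.
elim: r => [|r IH] H; first by rewrite minn0.
rewrite -addn1 iotaD map_cat flatten_cat IH /= => [|k kr]; last by apply: H; lia.
rewrite add0n H ?addn1 //; case: ltnP => mr.
  have -> : (minn m r.+1 = minn m r + 1)%N by lia.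
  rewrite iotaD map_cat /= add0n.
  by have -> : minn m r = r by lia.
by rewrite !cats0; congr [seq a k | k <- iota 0 _]; lia.
Qed.

(** ** Reading the tape on one side of a centre *)

(** The number of digits before the tape ends, among the first [m]. *)
Definition run (m : nat) (o : nat -> option bool) : nat :=
  find (fun k => o k == None) (iota 0 m).

(** A tape that is too short is continued by zeros. *)
Definition tape_prefix (m : nat) (o : nat -> option bool) : seq bool :=
  mkseq (fun k => (k < run m o)%N && (o k == Some true)) m.

(** As far as can be seen within [m] symbols, the tape [o] carries the word [s]:
    either [s] is longer than [m], or the tape ends where [s] does. *)
Definition reads (m : nat) (o : nat -> option bool) (s : seq bool) : Prop :=
  (forall k, (k < m)%N -> (k < size s)%N -> o k = Some (nth false s k)) /\
  ((size s < m)%N -> o (size s) = None).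

Lemma readsW m m' o s : (m' <= m)%N -> reads m o s -> reads m' o s.
Proof.
move=> mm' [H1 H2]; split=> [k km' ks|sm']; first by apply: H1 => //; lia.
by apply: H2; lia.
Qed.

Lemma run_reads m o s : reads m o s -> run m o = minn m (size s).
Proof.
move=> [H1 H2]; rewrite /run; case: (leqP m (size s)) => h.
  by rewrite find_iota_none // => j jm; rewrite H1 //; lia.
by rewrite (@find_iota _ _ (size s)) ?H2 // => j js; rewrite H1 //; lia.
Qed.

Lemma tape_prefix_reads m o s : reads m o s ->
  tape_prefix m o = mkseq (nth false s) m.
Proof.
move=> rs; apply: (@eq_from_nth _ false) => [|k]; rewrite ?size_mkseq // => km.
rewrite !nth_mkseq // (run_reads rs) leq_min km /=.
case: ltnP => ks; last by rewrite nth_default.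
by rewrite (rs.1 k km ks); case: nth.
Qed.

Definition left_tape (x : full_shift 'I_6) (k : nat) : option bool :=
  lbit (x (- k.+1%:Z)).
Definition right_tape (x : full_shift 'I_6) (k : nat) : option bool :=
  rbit (x k.+1%:Z).

Section Code.
Variables (n : nat) (E : seq bool -> seq bool -> seq bool * seq bool).
Implicit Types (x y : full_shift 'I_6) (A B L R : seq bool).

(** If the tape goes on beyond the prefix that is exchanged, then its last digit
    is untouched and zeros at the end of the new prefix are significant.
    Otherwise they must be removed, as a finite tape ends in a one. *)
Definition retrim (o : nat -> option bool) (s : seq bool) : seq bool :=
  if (n < run n.+1 o)%N then s else trim s.

Definition written x := E (tape_prefix n (left_tape x)) (tape_prefix n (right_tape x)).
Definition new_left x := retrim (left_tape x) (written x).1.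
Definition new_right x := retrim (right_tape x) (written x).2.

Definition centre_ahead x := has (fun k : nat => x k.+1%:Z == s2) (iota 0 n).
Definition centre_behind x := has (fun k : nat => x (- k.+1%:Z) == s2) (iota 0 n).

(** The whole new prefixes are written in the block of the centre. In exchange,
    the digits at distance at most [n] from the centre have empty blocks. *)
Definition code_block x : seq 'I_6 :=
  if x 0 == s2 then rev (map lsym (new_left x)) ++ s2 :: map rsym (new_right x)
  else if x 0 == s5 then [:: s5]
  else if before_centre (x 0) then if centre_ahead x then [::] else [:: x 0]
  else if centre_behind x then [::] else [:: x 0].

Local Notation off := (offset code_block).

Lemma new_tapes_local x y : agree n.+1 x y ->
  [/\ run n (left_tape x) = run n (left_tape y),
      run n (right_tape x) = run n (right_tape y),
      new_left x = new_left y & new_right x = new_right y].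
Proof.
move=> xy.
have eqL k : (k <= n)%N -> left_tape x k = left_tape y k.
  by move=> kn; rewrite /left_tape xy //; lia.
have eqR k : (k <= n)%N -> right_tape x k = right_tape y k.
  by move=> kn; rewrite /right_tape xy //; lia.
have eqrun m (o o' : nat -> option bool) : (m <= n.+1)%N ->
    (forall k, (k <= n)%N -> o k = o' k) -> run m o = run m o'.
  move=> mn H; rewrite /run; apply: eq_in_find => k; rewrite mem_iota => km.
  by rewrite H //; lia.
have eqpre (o o' : nat -> option bool) :
    (forall k, (k <= n)%N -> o k = o' k) -> tape_prefix n o = tape_prefix n o'.
  move=> H; apply: (@eq_from_nth _ false) => [|k]; rewrite ?size_mkseq // => km.
  by rewrite !nth_mkseq // (eqrun _ o o') // H //; lia.
rewrite /new_left /new_right /retrim /written.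
rewrite (eqpre _ _ eqL) (eqpre _ _ eqR) (eqrun _ _ _ _ eqL) // (eqrun _ _ _ _ eqR) //.
by rewrite (eqrun _ _ _ _ eqL) // (eqrun _ _ _ _ eqR).
Qed.

Lemma code_block_local x y : agree n.+1 x y -> code_block x = code_block y.
Proof.
move=> xy; have [_ _ eL eR] := new_tapes_local xy.
have ca : centre_ahead x = centre_ahead y.
  by apply: eq_in_has => k; rewrite mem_iota => km; rewrite xy //; lia.
have cb : centre_behind x = centre_behind y.
  by apply: eq_in_has => k; rewrite mem_iota => km; rewrite xy //; lia.
by rewrite /code_block eL eR ca cb (xy 0).
Qed.

(** The words are read away from the centre, and the tapes may continue after
    them. *)
Definition centred A B x : Prop :=
  [/\ x 0 = s2,
      forall k, (k < size A)%N -> x (- k.+1%:Z) = lsym (nth false A k) &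
      forall k, (k < size B)%N -> x k.+1%:Z = rsym (nth false B k)].

Lemma left_blocks A B x : centred A B x ->
  flatten [seq code_block (shift (- (size A)%:Z + k%:Z) x) | k <- iota 0 (size A)]
  = rev (map lsym (drop n A)).
Proof.
move=> [x0 xA xB].
rewrite (@flatten_iota_take _ _ (fun k => lsym (nth false A (size A - k.+1))) (size A - n)).
  apply: (@eq_from_nth _ s0) => [|k]; rewrite size_map size_iota.
    by rewrite size_rev size_map size_drop; lia.
  move=> kA; rewrite (nth_map 0%N) ?size_iota // nth_iota // add0n.
  rewrite nth_rev ?size_map ?size_drop; last by lia.
  rewrite (nth_map false) ?size_drop; last by lia.
  by rewrite nth_drop; congr (lsym (nth _ _ _)); lia.
move=> k kA; set y := shift _ x.
have yE j : y j = x (- (size A)%:Z + k%:Z + j) by rewrite /y /shift addrC.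
have y0 : y 0 = lsym (nth false A (size A - k.+1)).
  by rewrite -xA; [rewrite yE; congr x|]; lia.
have ca : centre_ahead y = ~~ (k < size A - n)%N.
  apply/hasP/idP => [[j]|h].
    rewrite mem_iota yE => jn /eqP; apply: contra_eqN => kAn.
    have -> : - (size A)%:Z + k%:Z + j.+1%:Z = - (size A - k.+2 - j).+1%:Z by lia.
    by rewrite xA; [case: nth|lia].
  exists (size A - k.+1)%N; first by rewrite mem_iota; lia.
  by rewrite yE; apply/eqP; rewrite -x0; congr x; lia.
rewrite /code_block ca y0 if_neg.
by case: (nth _ _ _).
Qed.

Lemma right_blocks A B x : centred A B x ->
  flatten [seq code_block (shift (1 + k%:Z) x) | k <- iota 0 (size B)]
  = map rsym (drop n B).
Proof.
move=> [x0 xA xB].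
rewrite (@flatten_iota_drop _ _ (fun k => rsym (nth false B k)) n).
  apply: (@eq_from_nth _ s0) => [|k]; rewrite size_map size_iota.
    by rewrite size_map size_drop.
  move=> kA; rewrite (nth_map 0%N) ?size_iota // nth_iota //.
  by rewrite (nth_map false) ?size_drop // nth_drop.
move=> k kB; set y := shift _ x.
have yE j : y j = x (k.+1%:Z + j) by rewrite /y /shift addrC; congr x; lia.
have y0 : y 0 = rsym (nth false B k) by rewrite yE addr0 xB.
have cb : centre_behind y = (k < n)%N.
  apply/hasP/idP => [[j]|h].
    rewrite mem_iota yE => jn /eqP; apply: contra_eqT; rewrite -leqNgt => nk.
    have -> : k.+1%:Z - j.+1%:Z = (k - j.+1).+1%:Z by lia.
    by rewrite xB; [case: nth|lia].
  exists k; first by rewrite mem_iota; lia.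
  by rewrite yE; apply/eqP; rewrite -x0; congr x; lia.
by rewrite /code_block cb y0; case: (nth _ _ _).
Qed.

Lemma centred_take A B x (a b : nat) : centred A B x ->
  centred (take a A) (take b B) x.
Proof.
move=> [x0 xA xB]; split=> // k; rewrite size_take_min leq_min => /andP[ka kA].
  by rewrite nth_take // xA.
by rewrite nth_take // xB.
Qed.

Lemma offset_left A B x (a : nat) : centred A B x -> (a <= size A)%N ->
  off x (- a%:Z) = - (a - n)%N%:Z.
Proof.
move=> cx aA; have := offset_segment code_block x (- a%:Z) a.
have cx' := centred_take a (size B) cx.
have := left_blocks cx'; rewrite size_takel // => ->.
rewrite addNr offset0 size_rev size_map size_drop size_takel //; lia.
Qed.

Lemma offset_right A B x (b : nat) : centred A B x -> (b <= size B)%N ->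
  off x b.+1%:Z = (size (code_block x))%:Z + (b - n)%N%:Z.
Proof.
move=> cx bB; have := offset_segment code_block x 1 b.
have cx' := centred_take (size A) b cx.
have := right_blocks cx'; rewrite size_takel // => ->.
have -> : 1 + b%:Z = b.+1%:Z by lia.
rewrite size_map size_drop size_takel // => ->.
by have := offsetS code_block x 0; rewrite offset0 !add0r shift0 => ->.
Qed.

Lemma size_code_centre A B x : centred A B x ->
  size (code_block x) = (size (new_left x) + size (new_right x)).+1.
Proof.
by case=> x0 _ _; rewrite /code_block x0 /= size_cat /= size_rev !size_map addnS.
Qed.

End Code.

(** * The action on cells *)

Definition pad (s : seq bool) : cantor_space := prefix_cat s (fun=> false).

Lemma padE s k : pad s k = nth false s k.
Proof. by rewrite /pad /prefix_cat; case: ltnP => // h; rewrite nth_default. Qed.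

Lemma pad_trim s : pad (trim s) = pad s.
Proof. by apply/funext => k; rewrite !padE nth_trim. Qed.

Lemma pad_cat s t : pad (s ++ t) = prefix_cat s (pad t).
Proof. exact: prefix_cat_cat. Qed.

Lemma pad_prefix (m : nat) s :
  pad s = prefix_cat (mkseq (nth false s) m) (pad (drop m s)).
Proof.
apply/funext => k; rewrite padE /prefix_cat size_mkseq.
by case: ltnP => h; [rewrite nth_mkseq|rewrite padE nth_drop subnKC].
Qed.

Lemma pad_inj s t : trimmed s -> trimmed t -> pad s = pad t -> s = t.
Proof.
move=> ts tt st; apply: nth_inj_trimmed => // k.
by rewrite -!padE st.
Qed.

Lemma before_cell L R x (k : nat) : cell L R x -> (k < (size L).+1)%N ->
  before_centre (x k%:Z).
Proof.
move=> cx; case: k => [|k] kL; first by rewrite (cell_first cx).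
have h : (size L - k.+1 < size L)%N by lia.
have := cell_left cx h.
have -> : (size L).+1%:Z - (size L - k.+1).+1%:Z = k.+1%:Z by lia.
by move=> ->; case: nth.
Qed.

Lemma after_cell L R x (k : nat) : cell L R x -> (k < size R)%N ->
  ~~ before_centre (x ((size L).+1%:Z + k.+1%:Z)) /\
  x ((size L).+1%:Z + k.+1%:Z) <> s2.
Proof. by move=> cx kR; rewrite (cell_right cx kR); case: nth. Qed.

Section CellCode.
Variables (n : nat) (E : seq bool -> seq bool -> seq bool * seq bool).
Local Notation w := (code_block n E).
Local Notation off := (offset w).
Local Notation code := (block_code s5 w).
Local Notation new_left := (new_left n E).
Local Notation new_right := (new_right n E).

(** The image of a pair of finite tapes. That it is the image under the element
    of 2V itself is [star_pad]. *)
Definition star_left (L R : seq bool) : seq bool :=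
  trim ((E (mkseq (nth false L) n) (mkseq (nth false R) n)).1 ++ drop n L).
Definition star_right (L R : seq bool) : seq bool :=
  trim ((E (mkseq (nth false L) n) (mkseq (nth false R) n)).2 ++ drop n R).

Lemma star_left_trimmed L R : trimmed (star_left L R).
Proof. exact: trim_trimmed. Qed.
Lemma star_right_trimmed L R : trimmed (star_right L R).
Proof. exact: trim_trimmed. Qed.

Section OneCell.
Variables (L R : seq bool) (x : full_shift 'I_6).
Hypotheses (tL : trimmed L) (tR : trimmed R) (cx : cell L R x).
Local Notation c := ((size L).+1%:Z).
Local Notation y := (shift c x).

Lemma centred_cell : centred L R y.
Proof.
split; first by rewrite /shift add0r (cell_centre cx).
  by move=> k kL; rewrite /shift addrC (cell_left cx).
by move=> k kR; rewrite /shift addrC (cell_right cx).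
Qed.

Lemma reads_left : reads n.+1 (left_tape y) L.
Proof.
split=> [k _ kL|_]; rewrite /left_tape /shift addrC.
  by rewrite (cell_left cx) // lsymK.
by rewrite subrr (cell_first cx).
Qed.

Lemma reads_right : reads n.+1 (right_tape y) R.
Proof.
split=> [k _ kR|_]; rewrite /right_tape /shift addrC.
  by rewrite (cell_right cx) // rsymK.
have -> : c + (size R).+1%:Z = (size (cellword L R))%:Z by rewrite size_cellword; lia.
by rewrite (cell_last cx).
Qed.

(** Whether or not the tape is longer than the reading range, the local rule
    yields the trimmed word. *)
Lemma retrim_drop o s A : trimmed A -> reads n.+1 o A ->
  retrim n o s ++ drop n A = trim (s ++ drop n A).
Proof.
move=> tA rA; rewrite /retrim (run_reads rA) leq_min ltnSn /=; case: ltnP => h.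
  by rewrite trim_id // trimmed_cat_drop.
by rewrite drop_oversize ?cats0.
Qed.

Lemma new_left_cell : new_left y ++ drop n L = star_left L R.
Proof.
rewrite /new_left (retrim_drop _ tL reads_left) /star_left /written.
rewrite (tape_prefix_reads (readsW (leqnSn n) reads_left)).
by rewrite (tape_prefix_reads (readsW (leqnSn n) reads_right)).
Qed.

Lemma new_right_cell : new_right y ++ drop n R = star_right L R.
Proof.
rewrite /new_right (retrim_drop _ tR reads_right) /star_right /written.
rewrite (tape_prefix_reads (readsW (leqnSn n) reads_left)).
by rewrite (tape_prefix_reads (readsW (leqnSn n) reads_right)).
Qed.

Lemma size_star_left : (size (star_left L R) = size (new_left y) + (size L - n))%N.
Proof. by rewrite -new_left_cell size_cat size_drop. Qed.

Lemma size_star_right : (size (star_right L R) = size (new_right y) + (size R - n))%N.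
Proof. by rewrite -new_right_cell size_cat size_drop. Qed.

Lemma block_first (z : full_shift 'I_6) : z 0 = s5 -> w z = [:: s5].
Proof. by rewrite /code_block => ->. Qed.

(** The centre of the new cell lies [size (new_left y)] symbols inside the block
    of the old centre. *)
Lemma offset_cell_centre :
  off x c + (size (new_left y))%:Z = (size (star_left L R)).+1%:Z.
Proof.
have := offset_segment w x 1 (size L).
have -> : 1 + (size L)%:Z = c by lia.
have := left_blocks n E centred_cell.
have -> : [seq w (shift (- (size L)%:Z + k%:Z) y) | k <- iota 0 (size L)] =
    [seq w (shift (1 + k%:Z) x) | k <- iota 0 (size L)].
  by apply: eq_map => k; rewrite shift_comp; congr (w (shift _ x)); lia.
move=> -> ->; have := offsetS w x 0.
rewrite offset0 !add0r shift0 (block_first (cell_first cx)) => ->.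
by rewrite size_rev size_map size_drop size_star_left /=; lia.
Qed.

Lemma cell_blocks :
  flatten [seq w (shift k%:Z x) | k <- iota 0 (size (cellword L R))] =
  cellword (star_left L R) (star_right L R).
Proof.
have iotaM m r : flatten [seq w (shift k%:Z x) | k <- iota m r] =
    flatten [seq w (shift (m + k)%N%:Z x) | k <- iota 0 r].
  by rewrite -{1}(addn0 m) iotaDl -map_comp.
have -> : size (cellword L R) = (1 + (size L + (1 + size R)))%N.
  by rewrite size_cellword; lia.
rewrite !iotaD !map_cat !flatten_cat !iotaM /= !addn0 !cats0.
rewrite shift0 (block_first (cell_first cx)).
have -> : flatten [seq w (shift (0 + 1 + k)%N%:Z x) | k <- iota 0 (size L)] =
    rev (map lsym (drop n L)).
  rewrite -(left_blocks n E centred_cell); congr flatten; apply: eq_map => k.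
  by rewrite shift_comp; congr (w (shift _ x)); lia.
have -> : flatten [seq w (shift (0 + 1 + size L + 1 + k)%N%:Z x) | k <- iota 0 (size R)] =
    map rsym (drop n R).
  rewrite -(right_blocks n E centred_cell); congr flatten; apply: eq_map => k.
  by rewrite shift_comp; congr (w (shift _ x)); lia.
have -> : (0 + 1 + size L)%N%:Z = c by lia.
have [y0 _ _] := centred_cell.
rewrite /code_block y0 /= /cellword -new_left_cell -new_right_cell.
by rewrite !map_cat rev_cat -!catA.
Qed.

Lemma offset_cell : off x (size (cellword L R))%:Z =
  (size (cellword (star_left L R) (star_right L R)))%:Z.
Proof.
have := offset_segment w x 0 (size (cellword L R)).
rewrite add0r offset0 add0r => ->; rewrite -cell_blocks.
by congr (size (flatten _))%:Z; apply: eq_map => k; rewrite add0r.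
Qed.

Lemma code_cell : cell (star_left L R) (star_right L R) (code x).
Proof.
move=> k; rewrite leq_eqVlt => /orP[/eqP ->|kd]; last first.
  rewrite -[k%:Z]add0r -{1}(offset0 w x); apply: block_code_segment kd.
  by rewrite -cell_blocks; congr flatten; apply: eq_map => j; rewrite add0r.
rewrite nth_default // -offset_cell.
have wd : w (shift (size (cellword L R))%:Z x) = [:: s5].
  by apply: block_first; rewrite /shift add0r (cell_last cx).
rewrite (@block_codeE _ s5 w x (size (cellword L R))%:Z).
  by rewrite wd subrr.
by rewrite offsetS wd lexx ltrDl.
Qed.

End OneCell.

(** ** The change of time along the flow *)

Section Time.
Variable R : realType.
Implicit Types (x : full_shift 'I_6) (t : R).

(** The position in the image of the centre at position [i]. *)
Definition centre_pos x (i : int) : int :=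
  off x i + (size (new_left (shift i x)))%:Z.

(** The change of length of the left half of the cell. The run counts the digits
    that are lost, at most [n]. *)
Definition stretch_left x : R :=
  (size (new_left x))%:R - (run n (left_tape x))%:R.
Definition stretch_right x : R :=
  (size (new_right x))%:R - (run n (right_tape x))%:R.

Definition dist_ahead x : nat := find (fun k : nat => x k%:Z == s2) (iota 0 n.+2).
Definition dist_behind x : nat := find (fun k : nat => x (- k%:Z) == s2) (iota 0 n.+2).

(** The time on the edge [0 <= t <= 1] after the origin. Only distances below
    [n.+2] from a centre are looked at: beyond, the image of the edge is a copy
    of it, in the same time, because [code_block] copies the symbols there. *)
Definition edge_time x t : R :=
  if before_centre (x 0) then
    let e := dist_ahead x in
    if (e < n.+2)%N then
      (centre_pos x e%:Z)%:~R - slide (stretch_left (shift e%:Z x)) (e%:R - t)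
    else t
  else
    let d := dist_behind x in
    if (d < n.+2)%N then
      (centre_pos x (- d%:Z))%:~R + slide (stretch_right (shift (- d%:Z) x)) (d%:R + t)
    else t.

Definition code_time x t : R :=
  let i := Num.floor t in (off x i)%:~R + edge_time (shift i x) (t - i%:~R).

Lemma code_time_shift x (i : int) t :
  code_time (shift i x) t = code_time x (t + i%:~R) - (off x i)%:~R.
Proof.
rewrite /code_time floorDrz ?intr_int // intrKfloor; set j := Num.floor t.
rewrite shift_comp (addrC j i) offsetD !intrD.
have -> : t + i%:~R - (i%:~R + j%:~R) = t - j%:~R by ring.
by ring.
Qed.

(** The slides prescribed near the centre agree with the identical copies made
    further away. Indeed the stretch is at least [- n], so that at distance
    [n.+1] or more the slide is a translation, by the amount by which the offsets
    are displaced. *)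
Lemma code_time_cell (L M : seq bool) x t : trimmed L -> trimmed M -> cell L M x ->
  0 <= t < (size (cellword L M))%:R ->
  code_time x t = (size (star_left L M)).+1%:R +
    slide2 ((size (star_left L M))%:R - (size L)%:R)
           ((size (star_right L M))%:R - (size M)%:R) (t - (size L).+1%:R).
Proof.
move=> tL tM cx /andP[t0 td].
set c : int := (size L).+1%:Z; set y := shift c x.
have cy : centred L M y := centred_cell cx.
have E0 := offset_cell_centre tL tM cx; rewrite -/c -/y in E0.
have sL := size_star_left tL tM cx; rewrite -/c -/y in sL.
have sM := size_star_right tL tM cx; rewrite -/c -/y in sM.
have E0r : (off x c)%:~R + (size (new_left y))%:R = (size (star_left L M)).+1%:R :> R.
  by rewrite -[RHS]/((size (star_left L M)).+1%:Z%:~R) -E0 intrD.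
have rL : run n (left_tape y) = minn n (size L).
  by have H := reads_left cx; exact: run_reads (readsW (leqnSn n) H).
have rM : run n (right_tape y) = minn n (size M).
  by have H := reads_right tL tM cx; exact: run_reads (readsW (leqnSn n) H).
have dL : stretch_left y = (size (star_left L M))%:R - (size L)%:R.
  rewrite /stretch_left rL sL natrD; case: (leqP n (size L)) => h.
    by rewrite natrB //; ring.
  have -> : (size L - n = 0)%N by lia.
  by ring.
have dM : stretch_right y = (size (star_right L M))%:R - (size M)%:R.
  rewrite /stretch_right rM sM natrD; case: (leqP n (size M)) => h.
    by rewrite natrB //; ring.
  have -> : (size M - n = 0)%N by lia.
  by ring.
rewrite /code_time.
have [k kE] : exists k : nat, Num.floor t = k%:Z.
  exists (absz (Num.floor t)); have : 0 <= Num.floor t by rewrite floor_ge0.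
  by lia.
have /andP[k1 k2] := floor_itv t.
rewrite kE in k1 k2 *; rewrite intrD in k2.
have {}k1 : k%:R <= t := k1.
have {}k2 : t < k%:R + 1 := k2.
rewrite -[k%:Z%:~R]/(k%:R).
have kd : (k < size (cellword L M))%N.
  by rewrite -(ltr_nat R); apply: le_lt_trans td.
rewrite size_cellword in kd.
have [kL|kL] := ltnP k (size L).+1.
  have tneg : t - (size L).+1%:R < 0.
    have : k%:R + 1 <= (size L).+1%:R :> R by rewrite natr1 ler_nat.
    by lra.
  rewrite /slide2 tneg /edge_time.
  have -> : shift k%:Z x 0 = x k%:Z by rewrite /shift add0r.
  rewrite (before_cell cx kL).
  have [near|far] := ltnP ((size L).+1 - k) n.+2.
    have -> : dist_ahead (shift k%:Z x) = ((size L).+1 - k)%N.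
      apply: find_iota => //; rewrite /shift.
        by rewrite (_ : _ + _ = c) ?(cell_centre cx) // /c; lia.
      move=> j jk; have h : (j + k < (size L).+1)%N by lia.
      by apply: contraL (before_cell cx h); rewrite PoszD => /eqP ->.
    have ke : k%:Z + ((size L).+1 - k)%N%:Z = c by rewrite /c; lia.
    have CP : off x k%:Z + centre_pos (shift k%:Z x) ((size L).+1 - k)%N%:Z =
        (size (star_left L M)).+1%:Z.
      by rewrite /centre_pos shift_comp addrA -offsetD ke E0.
    rewrite near shift_comp ke -/y addrA -intrD CP dL.
    congr (_ - slide _ _); rewrite natrB; last by lia.
    by rewrite opprB; ring.
  have -> : (dist_ahead (shift k%:Z x) < n.+2)%N = false.
    apply/negbTE; rewrite -leqNgt /dist_ahead find_iota_none // => j jn.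
    rewrite /shift; have h : (j + k < (size L).+1)%N by lia.
    by apply: contraL (before_cell cx h); rewrite PoszD => /eqP ->.
  have offk : off x k%:Z = k%:Z.
    case: k {k1 k2 kE kd} kL far => [|k] kL far; first by rewrite offset0.
    have := offsetD w x c (- ((size L) - k)%N%:Z).
    have -> : c + - (size L - k)%N%:Z = k.+1%:Z by rewrite /c; lia.
    rewrite -/y (offset_left n E cy) ?leq_subr // => ->; lia.
  rewrite offk -[k%:Z%:~R]/(k%:R).
  have nL : (n <= size L)%N by lia.
  have sLr : (size (star_left L M))%:R = (size (new_left y))%:R + ((size L)%:R - n%:R) :> R.
    by rewrite sL natrD natrB.
  have fr : k%:R + n%:R + 2 <= (size L)%:R + 1 :> R.
    by rewrite natr1 -!natrD ler_nat; lia.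
  have s0 : 0 <= (size (new_left y))%:R :> R by [].
  have n0 : 0 <= n%:R :> R by [].
  rewrite -!natr1 slide_translation; rewrite ?sLr; lra.
have [j kj] : exists j, k = ((size L).+1 + j)%N by exists (k - (size L).+1)%N; lia.
have kjR : k%:R = (size L).+1%:R + j%:R :> R by rewrite kj natrD.
have tpos : 0 <= t - (size L).+1%:R.
  by have : 0 <= j%:R :> R by []; lra.
rewrite /slide2 ifN -?leNgt // /edge_time.
have ck : k%:Z = c + j%:Z by rewrite kj /c; lia.
have notb : before_centre (shift k%:Z x 0) = false.
  rewrite /shift add0r ck; case: j {kj kjR ck} (kj) => [|j] kj.
    by rewrite addr0 /c (cell_centre cx).
  by apply/negbTE; have [] := after_cell cx (_ : (j < size M)%N) => //; lia.
rewrite notb.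
have [near|far] := ltnP j n.+2.
  have -> : dist_behind (shift k%:Z x) = j.
    apply: find_iota => //; rewrite /shift.
      by rewrite ck addrC addrK /c (cell_centre cx).
    move=> i ij; rewrite ck.
    have h : (j - i.+1 < size M)%N by lia.
    have -> : - i%:Z + (c + j%:Z) = (size L).+1%:Z + (j - i.+1).+1%:Z by rewrite /c; lia.
    by apply/eqP; have [] := after_cell cx h.
  have ke : k%:Z + - j%:Z = c by lia.
  have CP : off x k%:Z + centre_pos (shift k%:Z x) (- j%:Z) =
      (size (star_left L M)).+1%:Z.
    by rewrite /centre_pos shift_comp addrA -offsetD ke E0.
  rewrite near shift_comp ke -/y addrA -intrD CP dM.
  by congr (_ + slide _ _); rewrite kjR; ring.
have -> : (dist_behind (shift k%:Z x) < n.+2)%N = false.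
  apply/negbTE; rewrite -leqNgt /dist_behind find_iota_none // => i ij.
  rewrite /shift ck.
  have h : (j - i.+1 < size M)%N by lia.
  have -> : - i%:Z + (c + j%:Z) = (size L).+1%:Z + (j - i.+1).+1%:Z by rewrite /c; lia.
  by apply/eqP; have [] := after_cell cx h.
have nM : (n <= size M)%N by lia.
have offk : (off x k%:Z)%:~R = (off x c)%:~R + (size (new_left y))%:R +
    (size (new_right y))%:R + (j%:R - n%:R) :> R.
  rewrite ck offsetD -/y; case: j {kjR ck notb} kj far => // j kj far.
  rewrite (offset_right n E cy); last by lia.
  rewrite (size_code_centre n E cy) !intrD -[(_.+1)%:Z%:~R]/(_.+1%:R) -[(j - n)%N%:Z%:~R]/((j - n)%N%:R).
  by rewrite natrB -?natr1 ?natrD; [ring|lia].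
rewrite offk E0r.
have sMr : (size (star_right L M))%:R = (size (new_right y))%:R + ((size M)%:R - n%:R) :> R.
  by rewrite sM natrD natrB.
have fr : n%:R + 2 <= j%:R :> R by rewrite -natrD ler_nat; lia.
have s0 : 0 <= (size (new_right y))%:R :> R by [].
have n0 : 0 <= n%:R :> R by [].
by rewrite slide_translation; rewrite ?sMr; lra.
Qed.

End Time.
End CellCode.

(** ** Growth and locality of the code *)

Section CodeLift.
Variables (n : nat) (E : seq bool -> seq bool -> seq bool * seq bool).
Local Notation w := (code_block n E).
Local Notation off := (offset w).
Local Notation new_left := (new_left n E).
Local Notation new_right := (new_right n E).
Implicit Types (x : full_shift 'I_6).

(** Among [n.+1] consecutive symbols one has a nonempty block. If the first one
    is a digit of the left tape with an empty block, then the centre follows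
    within distance [n]. If it is a digit of the right tape, then either a marker
    follows, or after [n] further digits of the tape the centre is too far behind
    for the block to be empty. *)
Lemma code_grows x : subshift_set X0 x -> grows w x.
Proof.
move=> /X0P Xx; exists n.+1 => i.
suff [k kn ne] : exists2 k : nat, (k <= n)%N & w (shift (i + k%:Z) x) <> [::].
  have h1 : i <= i + k%:Z by lia.
  have h2 : i + k%:Z + 1 <= i + n.+1%:Z by lia.
  apply: le_lt_trans (offset_le w x h1) _.
  apply: lt_le_trans (offset_le w x h2); rewrite offsetS ltrDl.
  by case: (w _) ne.
set z := shift i x.
have wz k : w (shift (i + k%:Z) x) = w (shift k%:Z z) by rewrite shift_comp.
have zk (k : nat) : shift k%:Z z 0 = z k%:Z by rewrite /shift add0r.
have stepz (k : nat) : step (z k%:Z) (z k.+1%:Z).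
  have -> : z k.+1%:Z = x (k%:Z + i + 1) by rewrite /z /shift; congr x; lia.
  exact: Xx.
have centre k : z k%:Z = s2 -> w (shift k%:Z z) <> [::].
  by move=> z2; rewrite /code_block zk z2 /=; case: rev.
have marker k : z k%:Z = s5 -> w (shift k%:Z z) <> [::].
  by move=> z5; rewrite /code_block zk z5.
have [z2|nz2] := eqVneq (z 0) s2.
  by exists 0%N => //; rewrite wz; exact: centre.
have [bz|nbz] := boolP (before_centre (z 0)).
  have [/hasP[j jn /eqP zj]|na] := boolP (centre_ahead n z).
    exists j.+1; first by move: jn; rewrite mem_iota; lia.
    by rewrite wz; exact: centre.
  exists 0%N => //; rewrite wz shift0 /code_block (negbTE na) bz (negbTE nz2).
  by case: ifP.
have [[k kn zk5]|no5] := pselect (exists2 k : nat, (k <= n)%N & z k%:Z = s5).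
  by exists k => //; rewrite wz; exact: marker.
have tape (k : nat) : (k <= n)%N -> (z k%:Z == s3) || (z k%:Z == s4).
  elim: k => [|k IH] kn; first by move: nz2 nbz; elim/sym_case: (z 0).
  have k5 : z k.+1%:Z <> s5 by move=> z5; apply: no5; exists k.+1.
  have := step_after (stepz k); have nb : ~~ before_centre (z k%:Z).
    by have := IH (ltnW kn); elim/sym_case: (z k%:Z).
  by move=> /(_ nb); move: k5; elim/sym_case: (z k.+1%:Z).
exists n => //; rewrite wz /code_block zk ifN; last first.
  by have := tape n (leqnn n); elim/sym_case: (z n%:Z).
rewrite ifN; last by have := tape n (leqnn n); elim/sym_case: (z n%:Z).
rewrite ifN; last by have := tape n (leqnn n); elim/sym_case: (z n%:Z).
rewrite ifN //; apply/hasPn => j; rewrite mem_iota => jn.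
have -> : shift n%:Z z (- j.+1%:Z) = z (n - j.+1)%N%:Z.
  by rewrite /shift -[in LHS]/z; congr z; lia.
have h : (n - j.+1 <= n)%N by lia.
by have := tape _ h; elim/sym_case: (z _).
Qed.

Variable R : realType.
Local Notation time := (code_time n E (R := R)).

Lemma code_time_int x (i : int) :
  time x i%:~R = (off x i)%:~R + edge_time n E (shift i x) 0.
Proof. by rewrite /code_time intrKfloor subrr. Qed.

Lemma centre_size x : x 0 = s2 ->
  size (w x) = (size (new_left x) + size (new_right x)).+1.
Proof. by move=> x2; apply: (@size_code_centre n E [::] [::]); split. Qed.

Lemma dist_aheadP x : (dist_ahead n x < n.+2)%N -> x (dist_ahead n x)%:Z = s2.
Proof.
move=> h; have := @nth_find nat 0%N (fun k : nat => x k%:Z == s2) (iota 0 n.+2).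
by rewrite has_find size_iota => /(_ h); rewrite nth_iota // add0n => /eqP.
Qed.

Lemma dist_behindP x : (dist_behind n x < n.+2)%N -> x (- (dist_behind n x)%:Z) = s2.
Proof.
move=> h; have := @nth_find nat 0%N (fun k : nat => x (- k%:Z) == s2) (iota 0 n.+2).
by rewrite has_find size_iota => /(_ h); rewrite nth_iota // add0n => /eqP.
Qed.

(** A slide exceeds the distance to the centre by at most the length of the new
    tape, and this length is absorbed by passing to the offset on the other side
    of the block of the centre. *)
Lemma code_time_bounds x (i : int) :
  (off x (i - n.+2%:Z))%:~R - n.+3%:R <= time x i%:~R <=
  (off x (i + n.+3%:Z))%:~R + n.+2%:R.
Proof.
rewrite code_time_int /edge_time; set y := shift i x.
have offle j k : j <= k -> (off x j)%:~R <= (off x k)%:~R :> R.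
  by move=> jk; rewrite ler_int offset_le.
have n2 : 0 <= n.+2%:R :> R by [].
have n3 : n.+3%:R = n.+2%:R + 1 :> R by rewrite natr1.
have hi : (off x i)%:~R <= (off x (i + n.+3%:Z))%:~R :> R by apply: offle; lia.
have lo : (off x (i - n.+2%:Z))%:~R <= (off x i)%:~R :> R by apply: offle; lia.
have pos (j : int) : (off x i)%:~R + (centre_pos n E y j)%:~R =
    (off x (i + j))%:~R + (size (new_left (shift (i + j) x)))%:R :> R.
  by rewrite /centre_pos /y intrD addrA -intrD -offsetD shift_comp.
case: ifP => _; case: ifP => [h|_]; try by rewrite addr0; lra.
- set e := dist_ahead n y in h *.
  rewrite subr0 addrA pos; set z := shift (i + e%:Z) x.
  have zE : shift e%:Z y = z by rewrite /y shift_comp.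
  have z2 : z 0 = s2.
    by rewrite -zE /shift add0r; exact: dist_aheadP.
  have e2 : e%:R <= n.+2%:R :> R by rewrite ler_nat ltnW.
  have e0 : 0 <= e%:R :> R by [].
  have : (off x (i - n.+2%:Z))%:~R <= (off x (i + e%:Z))%:~R :> R by apply: offle; lia.
  have : (off x (i + e%:Z))%:~R + (size (new_left z))%:R <= (off x (i + n.+3%:Z))%:~R :> R.
    apply: le_trans (_ : (off x (i + e%:Z + 1))%:~R <= _); last by apply: offle; lia.
    rewrite offsetS -/z (centre_size z2) intrD lerD2l.
    by rewrite -[X in _ <= X]/((_.+1)%:R) ler_nat; lia.
  have := slide_ge0 (stretch_left n E R z) e0.
  have : stretch_left n E R z <= (size (new_left z))%:R by rewrite gerBl.
  have := slide_le (stretch_left n E R z) e0.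
  have : 0 <= (size (new_left z))%:R :> R by [].
  rewrite zE le_max => ? /orP[]; lra.
- set d := dist_behind n y in h *.
  rewrite addr0 addrA pos; set z := shift (i + - d%:Z) x.
  have zE : shift (- d%:Z) y = z by rewrite /y shift_comp.
  have z2 : z 0 = s2.
    by rewrite -zE /shift add0r; exact: dist_behindP.
  have d2 : d%:R <= n.+2%:R :> R by rewrite ler_nat ltnW.
  have d0 : 0 <= d%:R :> R by [].
  have : (off x (i - n.+2%:Z))%:~R <= (off x (i - d%:Z))%:~R :> R by apply: offle; lia.
  have : (off x (i - d%:Z))%:~R + (size (new_left z))%:R + (size (new_right z))%:R + 1
      <= (off x (i + n.+3%:Z))%:~R :> R.
    apply: le_trans (_ : (off x (i - d%:Z + 1))%:~R <= _); last by apply: offle; lia.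
    rewrite offsetS -/z (centre_size z2) intrD -!addrA lerD2l.
    by rewrite -[X in _ <= X]/((_.+1)%:R) natr1 -natrD addnS.
  have := slide_ge0 (stretch_right n E R z) d0.
  have : stretch_right n E R z <= (size (new_right z))%:R by rewrite gerBl.
  have := slide_le (stretch_right n E R z) d0.
  have : 0 <= (size (new_left z))%:R :> R by [].
  have : 0 <= (size (new_right z))%:R :> R by [].
  rewrite zE le_max => ? ? /orP[]; lra.
Qed.

(** The edge depends on a centre at distance at most [n.+1], whose block depends
    on [n.+1] symbols around it. *)
Lemma edge_time_local x y (t : R) : agree (n + n + 4)%N x y ->
  edge_time n E x t = edge_time n E y t.
Proof.
move=> xy.
have sh (m : int) : `|m| <= n.+2%:Z -> agree n.+1 (shift m x) (shift m y).
  by move=> mn; apply: agree_shift xy; lia.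
have eoff (m : int) : `|m| <= n.+2%:Z -> off x m = off y m.
  move=> mn; apply: (@offset_local _ w n.+1 (@code_block_local n E)).
  by apply: agreeW xy; lia.
rewrite /edge_time (xy 0) //.
have -> : dist_ahead n x = dist_ahead n y.
  by apply: eq_in_find => k; rewrite mem_iota => km; rewrite xy //; lia.
have -> : dist_behind n x = dist_behind n y.
  by apply: eq_in_find => k; rewrite mem_iota => km; rewrite xy //; lia.
rewrite /centre_pos /stretch_left /stretch_right.
case: ifP => _; case: ifP => h //.
  have h' : `|(dist_ahead n y)%:Z| <= n.+2%:Z by lia.
  by rewrite eoff //; have [-> _ -> _] := new_tapes_local E (sh _ h').
have h' : `|- (dist_behind n y)%:Z| <= n.+2%:Z by lia.
by rewrite eoff //; have [_ -> -> ->] := new_tapes_local E (sh _ h').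
Qed.

Lemma code_time_local x (b : R) : exists k, forall y, agree k x y ->
  forall t, `|t| <= b -> time y t = time x t.
Proof.
pose B := absz (Num.floor (`|b| + 1)).
exists (B + 1 + (n + n + 4))%N => y xy t tb; rewrite /code_time.
set i := Num.floor t.
have iB : `|i| <= (B + 1)%N%:Z.
  have bB : b <= B%:R.
    have /andP[_] := floor_itv (`|b| + 1); rewrite intrD.
    have : 0 <= Num.floor (`|b| + 1) by rewrite floor_ge0 addr_ge0.
    rewrite /B => f0; have -> : (absz (Num.floor (`|b| + 1)))%:R = (Num.floor (`|b| + 1))%:~R :> R.
      by rewrite -[LHS]/((absz (Num.floor (`|b| + 1)))%:Z%:~R) gez0_abs.
    by have := ler_norm b; lra.
  have /andP[i1 i2] := floor_itv t; rewrite -/i intrD in i1 i2.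
  move: tb; rewrite ler_norml => /andP[t1 t2].
  have h1 : i%:~R <= B%:Z%:~R :> R by rewrite -[X in _ <= X]/(B%:R); lra.
  have h2 : (- B%:Z - 1)%:~R <= i%:~R :> R.
    by rewrite intrD intrN -[B%:Z%:~R]/(B%:R); lra.
  by move: h1 h2; rewrite !ler_int; lia.
have -> : off y i = off x i.
  apply/esym; apply: (@offset_local _ w n.+1 (@code_block_local n E)).
  by apply: agreeW xy; lia.
congr (_ + _); apply/esym/edge_time_local.
by apply: agree_shift xy; lia.
Qed.

End CodeLift.

(** * Cell maps *)

Section CellMaps.
Variable R : realType.
Implicit Types (t : R) (l m : nat).

(** The change of time on a cell with tapes of lengths [l] and [m] whose image
    has tapes of lengths [l'] and [m'], both cells starting at [0]. *)
Definition cell_map l m l' m' t : R :=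
  l'.+1%:R + slide2 (l'%:R - l%:R) (m'%:R - m%:R) (t - l.+1%:R).

Lemma cell_map_id l m t : cell_map l m l m t = t.
Proof. by rewrite /cell_map !subrr slide2_00; ring. Qed.

Lemma cell_map_comp l m l' m' l'' m'' t :
  cell_map l' m' l'' m'' (cell_map l m l' m' t) = cell_map l m l'' m'' t.
Proof.
rewrite /cell_map addrAC subrr add0r slide2D.
by congr (_ + slide2 _ _ _); ring.
Qed.

Lemma cell_map_incr l m l' m' : {homo cell_map l m l' m' : s t / s < t}.
Proof. by move=> s t st; rewrite ltrD2l slide2_incr // ltrD2r. Qed.

Lemma cell_map_first l m l' m' : cell_map l m l' m' 0 = 0.
Proof.
rewrite /cell_map sub0r /slide2 oppr_lt0 ltr0Sn opprK slide_translation.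
- by rewrite -!natr1; ring.
- by rewrite ler1n.
- have -> : l.+1%:R + (l'%:R - l%:R) = l'.+1%:R :> R by rewrite -!natr1; ring.
  by rewrite ler1n.
Qed.

Lemma cell_map_last l m l' m' : cell_map l m l' m' (l + m).+2%:R = (l' + m').+2%:R.
Proof.
have e k j : (k + j).+2%:R - k.+1%:R = j.+1%:R :> R.
  by rewrite -!natr1 natrD; ring.
rewrite /cell_map e /slide2 ltrn0 slide_translation.
- by rewrite -!natr1 natrD; ring.
- by rewrite ler1n.
- have -> : m.+1%:R + (m'%:R - m%:R) = m'.+1%:R :> R by rewrite -!natr1; ring.
  by rewrite ler1n.
Qed.

Lemma cell_map_range l m l' m' t :
  0 <= t < (l + m).+2%:R -> 0 <= cell_map l m l' m' t < (l' + m').+2%:R.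
Proof.
move=> /andP[t0 td]; rewrite -(cell_map_last l m) cell_map_incr // andbT.
by rewrite -(cell_map_first l m l' m') (le_mono (@cell_map_incr l m l' m')).
Qed.

End CellMaps.

(** ** Marked points *)

Lemma cell_no_marker L M x (k : nat) : cell L M x ->
  (0 < k < size (cellword L M))%N -> x k%:Z <> s5.
Proof.
move=> cx; rewrite size_cellword => /andP[k0 kd].
have [kL|kL] := ltnP k (size L).+1.
  have h : (size L - k < size L)%N by lia.
  have := cell_left cx h; have -> : (size L).+1%:Z - (size L - k).+1%:Z = k%:Z by lia.
  by move=> ->; case: nth.
have [->|kL1] := eqVneq k (size L).+1; first by rewrite (cell_centre cx).
have h : (k - (size L).+2 < size M)%N by lia.
have := cell_right cx h.
have -> : (size L).+1%:Z + (k - (size L).+2).+1%:Z = k%:Z by lia.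
by move=> ->; case: nth.
Qed.

Definition marked (x : full_shift 'I_6) : Prop :=
  [/\ subshift_set X0 x, recurrent x & x 0 = s5].

Lemma marked_cell x : marked x -> exists L M, [/\ trimmed L, trimmed M & cell L M x].
Proof. by case=> Xx rx x0; exact: cell_exists. Qed.

Lemma marked_shift x (i : int) : subshift_set X0 x -> recurrent x -> x i = s5 ->
  marked (shift i x).
Proof.
move=> Xx rx xi; split; [exact: subshift_shift|exact: recurrent_shift|].
by rewrite /shift add0r.
Qed.

Lemma marked_next L M x : marked x -> cell L M x ->
  marked (shift (size (cellword L M))%:Z x).
Proof. by case=> Xx rx _ cx; apply: marked_shift => //; exact: cell_last. Qed.

Lemma cell_at (R : realType) x (t : R) : subshift_set X0 x -> recurrent x ->
  exists (i : int) L M, [/\ x i = s5, trimmed L, trimmed M, cell L M (shift i x) &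
    i%:~R <= t < (i + (size (cellword L M))%:Z)%:~R].
Proof.
move=> Xx rx; apply: (@cell_cover _ R x (fun i => i%:~R) t Xx rx).
- by move=> i j ij; rewrite ler_int.
- by exists (Num.floor t); have /andP[] := floor_itv t.
- by exists (Num.floor t + 1); have /andP[] := floor_itv t.
Qed.

Lemma marked_prev x : marked x -> exists L M x', [/\ trimmed L, trimmed M,
  marked x', cell L M x' & x = shift (size (cellword L M))%:Z x'].
Proof.
move=> [Xx rx x0].
have below : exists i : int, (i <= -1)%O by exists (-1).
have above : exists i : int, (-1 < i)%O by exists 0.
have [i [L [M [xi tL tM cx /andP[i1 i2]]]]] :=
  @cell_cover _ int x id (-1) Xx rx (fun i j ij => ij) below above.
have i0 : i + (size (cellword L M))%:Z = 0.
  have [//|ne] := eqVneq (i + (size (cellword L M))%:Z) 0.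
  have h : (0 < `|i|%N < size (cellword L M))%N by lia.
  by case: (cell_no_marker cx h); rewrite /shift -x0; congr x; lia.
exists L, M, (shift i x); split=> //; first exact: marked_shift.
by rewrite shift_comp i0 shift0.
Qed.

(** From a marker the equality propagates cell by cell in both directions. *)
Lemma cellwise_eq (A B : full_shift 'I_6 -> full_shift 'I_6) :
  (forall L M x, trimmed L -> trimmed M -> marked x -> cell L M x ->
    exists d : nat, [/\ (0 < d)%N,
      A (shift (size (cellword L M))%:Z x) = shift d%:Z (A x),
      B (shift (size (cellword L M))%:Z x) = shift d%:Z (B x) &
      forall k : nat, (k <= d)%N -> A x k%:Z = B x k%:Z]) ->
  forall x, marked x -> A x = B x.
Proof.
move=> AB x mx; apply/funext => j.
have [m jm] : exists m : nat, `|j| <= m%:Z by exists `|j|%N; lia.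
elim/ltn_ind: m x mx j jm => m IH x mx j jm.
have [j0|j0] := leP 0 j.
  have [L [M [tL tM cx]]] := marked_cell mx.
  have [d [d0 eA eB e]] := AB _ _ _ tL tM mx cx.
  have [jd|jd] := leP j d%:Z; first by have := e `|j|%N; rewrite gez0_abs //; apply; lia.
  have h : (absz (j - d%:Z)%R < m)%N by lia.
  have := IH _ h _ (marked_next mx cx) (j - d%:Z).
  by rewrite eA eB /shift subrK; apply; lia.
have [L [M [x' [tL tM mx' cx' xE]]]] := marked_prev mx.
have [d [d0 eA eB e]] := AB _ _ _ tL tM mx' cx'.
rewrite xE eA eB /shift.
have [jd|jd] := leP 0 (j + d%:Z).
  by have := e (absz (j + d%:Z)%R); rewrite gez0_abs //; apply; lia.
have h : (absz (j + d%:Z)%R < m)%N by lia.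
by apply: IH h _ mx' _ _; lia.
Qed.

(** * The homeomorphism of the mapping torus given by a code *)

Section CodeOnShift.
Variables (n : nat) (E : seq bool -> seq bool -> seq bool * seq bool).
Local Notation w := (code_block n E).
Local Notation off := (offset w).
Local Notation code := (block_code s5 w).
Local Notation star_left := (star_left n E).
Local Notation star_right := (star_right n E).
Implicit Types (x : full_shift 'I_6).

Lemma code_shift x (i : int) : subshift_set X0 x ->
  code (shift i x) = shift (off x i) (code x).
Proof. by move=> Xx; apply: block_code_shift; exact: code_grows. Qed.

Lemma offset_next L M x (i : int) : trimmed L -> trimmed M -> cell L M (shift i x) ->
  off x (i + (size (cellword L M))%:Z) =
  off x i + (size (cellword (star_left L M) (star_right L M)))%:Z.
Proof. by move=> tL tM cx; rewrite offsetD (offset_cell n E tL tM cx). Qed.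

Lemma code_recurrent_mem x : subshift_set X0 x -> recurrent x ->
  subshift_set X0 (code x).
Proof.
move=> Xx rx; have gx := code_grows n E Xx; apply/X0P => j.
have below : exists i : int, (off x i <= j)%O by exact: grows_lower gx.
have above : exists i : int, (j < off x i)%O by exact: grows_upper gx.
have [i [L [M [xi tL tM cx /andP[i1 i2]]]]] :=
  @cell_cover _ int x (off x) j Xx rx (fun i j ij => offset_le w x ij) below above.
rewrite (offset_next tL tM cx) in i2.
have cc := @code_cell n E _ _ _ tL tM cx.
have h : (absz (j - off x i)%R < size (cellword (star_left L M) (star_right L M)))%N by lia.
have := cell_step (star_left_trimmed n E L M) (star_right_trimmed n E L M) cc h.
rewrite code_shift // /shift.
have -> : (absz (j - off x i)%R)%:Z + off x i = j by lia.
by have -> : (absz (j - off x i)%R).+1%:Z + off x i = j + 1 by lia.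
Qed.

(** Whether two consecutive symbols are admissible is a local condition, so it is
    inherited from the recurrent points. *)
Lemma code_mem x : subshift_set X0 x -> subshift_set X0 (code x).
Proof.
move=> Xx; apply/X0P => j.
have [k Hk] := block_code_local s5 (@code_block_local n E) (`|j|.+1)%N (code_grows n E Xx).
have [y [Xy ry xy]] := recurrent_dense k Xx.
have a := Hk y xy; have /X0P/(_ j) := code_recurrent_mem Xy ry.
by rewrite -!a //; lia.
Qed.

Section TimeOnShift.
Variable R : realType.
Local Notation time := (code_time n E (R := R)).
Local Notation cmap L M := (cell_map (size L) (size M)
  (size (star_left L M)) (size (star_right L M))).

Lemma time_cell L M x (i : int) (t : R) :
  trimmed L -> trimmed M -> cell L M (shift i x) ->
  i%:~R <= t < (i + (size (cellword L M))%:Z)%:~R ->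
  time x t = (off x i)%:~R + cmap L M (t - i%:~R).
Proof.
move=> tL tM cx /andP[i1 i2]; rewrite intrD in i2.
have := code_time_shift n E x i (t - i%:~R); rewrite subrK => e.
have h : 0 <= t - i%:~R < (size (cellword L M))%:R.
  by apply/andP; split; [rewrite subr_ge0|rewrite ltrBlDl].
have := code_time_cell n E tL tM cx h; rewrite e /cell_map => <-.
by rewrite addrC subrK.
Qed.

Lemma time_cell_range L M x (i : int) (t : R) :
  trimmed L -> trimmed M -> cell L M (shift i x) ->
  i%:~R <= t < (i + (size (cellword L M))%:Z)%:~R ->
  (off x i)%:~R <= time x t < (off x (i + (size (cellword L M))%:Z))%:~R.
Proof.
move=> tL tM cx it; rewrite (time_cell tL tM cx it) (offset_next tL tM cx) intrD.
move: it; rewrite intrD => /andP[i1 i2]; rewrite lerDl ltrD2l.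
have h : 0 <= t - i%:~R < (size L + size M).+2%:R.
  rewrite subr_ge0 i1 ltrBlDl; apply: lt_le_trans i2 _.
  by rewrite size_cellword.
by have := cell_map_range (size (star_left L M)) (size (star_right L M)) h;
  rewrite size_cellword.
Qed.

(** In one cell the time is a [cell_map]; two times in different cells are
    separated by the image of a marker. *)
Lemma time_incr_recurrent x : subshift_set X0 x -> recurrent x ->
  {homo time x : s t / s < t}.
Proof.
move=> Xx rx s t st.
have [i [L [M [xi tL tM cx si]]]] := cell_at s Xx rx.
have [ti|ti] := ltP t (i + (size (cellword L M))%:Z)%:~R.
  rewrite (time_cell tL tM cx si) (@time_cell L M x i t) //.
    by rewrite ltrD2l cell_map_incr // ltrD2r.
  by rewrite ti (le_trans _ (ltW st)) //; case/andP: si.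
have /andP[_ s2] := time_cell_range tL tM cx si.
apply: lt_le_trans s2 _.
have [j [L1 [M1 [xj tL1 tM1 cx1 tj]]]] := cell_at t Xx rx.
have /andP[t1 _] := time_cell_range tL1 tM1 cx1 tj.
apply: le_trans t1; rewrite ler_int; apply: offset_le.
case/andP: tj => j1 j2; rewrite leNgt; apply/negP => ji.
have h2 : i + (size (cellword L M))%:Z < j + (size (cellword L1 M1))%:Z.
  by rewrite -(ltr_int R); apply: le_lt_trans j2.
have h : (0 < absz (i + (size (cellword L M))%:Z - j)%R < size (cellword L1 M1))%N.
  by clear - ji h2; lia.
case: (cell_no_marker cx1 h); rewrite /shift -(cell_last cx) /shift; congr x.
by clear - ji; lia.
Qed.

Lemma time_surj_recurrent x s : subshift_set X0 x -> recurrent x ->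
  exists t, time x t = s.
Proof.
move=> Xx rx; have gx := code_grows n E Xx.
have nu_le (i j : int) : i <= j -> (off x i)%:~R <= (off x j)%:~R :> R.
  by move=> ij; rewrite ler_int offset_le.
have /andP[f1 f2] := floor_itv s.
have below : exists i : int, ((off x i)%:~R <= s :> R)%O.
  have [i hi] := grows_lower (Num.floor s) gx; exists i.
  by apply: le_trans f1; rewrite ler_int.
have above : exists i : int, (s < (off x i)%:~R :> R)%O.
  have [i hi] := grows_upper (Num.floor s) gx; exists i.
  by apply: lt_le_trans f2 _; rewrite ler_int lezD1.
have [i [L [M [xi tL tM cx /andP[s1 s2]]]]] :=
  @cell_cover _ R x (fun i => (off x i)%:~R) s Xx rx nu_le below above.
rewrite (offset_next tL tM cx) intrD in s2.
have h : 0 <= s - (off x i)%:~R < (size (star_left L M) + size (star_right L M)).+2%:R.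
  rewrite subr_ge0 s1 ltrBlDl; apply: lt_le_trans s2 _.
  by rewrite size_cellword.
exists (i%:~R + cell_map (size (star_left L M)) (size (star_right L M))
  (size L) (size M) (s - (off x i)%:~R)).
have := cell_map_range (size L) (size M) h => /andP[c1 c2].
set c := cell_map _ _ _ _ _ in c1 c2 *.
have tin : i%:~R <= i%:~R + c < (i + (size (cellword L M))%:Z)%:~R.
  by rewrite lerDl c1 intrD ltrD2l size_cellword.
rewrite (time_cell tL tM cx tin) addrAC subrr add0r /c.
by rewrite cell_map_comp cell_map_id addrC subrK.
Qed.

Lemma time_incr x : subshift_set X0 x -> {homo time x : s t / s < t}.
Proof.
move=> Xx s t st; have [k H] := code_time_local n E x (Num.max `|s| `|t|).
have [y [Xy ry xy]] := recurrent_dense k Xx.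
rewrite -(H y xy) ?le_max ?lexx // -(H y xy) ?le_max ?lexx ?orbT //.
exact: time_incr_recurrent.
Qed.

(** The bounds on the time place [s] between the times of two integers, and on
    this interval the time is that of some recurrent point. *)
Lemma time_surj x s : subshift_set X0 x -> exists t, time x t = s.
Proof.
move=> Xx; have gx := code_grows n E Xx.
have [a ha] : exists a : int, time x a%:~R <= s.
  have [a ha] := grows_lower (Num.floor s - n.+2%:Z) gx; exists (a - n.+3%:Z).
  have /andP[_ h] := code_time_bounds n E R x (a - n.+3%:Z).
  apply: le_trans h _; rewrite subrK -lerBrDr.
  have /andP[f1 _] := floor_itv s; apply: le_trans (_ : (Num.floor s - n.+2%:Z)%:~R <= _).
    by rewrite ler_int.
  by rewrite intrD intrN lerD2r.
have [b hb] : exists b : int, s <= time x b%:~R.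
  have [b hb] := grows_upper (Num.floor s + n.+4%:Z) gx; exists (b + n.+2%:Z).
  have /andP[h _] := code_time_bounds n E R x (b + n.+2%:Z).
  apply: le_trans h; rewrite addrK lerBrDr.
  have /andP[_ f2] := floor_itv s; rewrite intrD in f2.
  have : (Num.floor s + n.+4%:Z)%:~R <= (off x b)%:~R :> R by rewrite ler_int ltW.
  rewrite intrD -[n.+4%:Z%:~R]/(n.+4%:R) -(natr1 n.+3); lra.
have [k H] := code_time_local n E x (Num.max `|a%:~R : R| `|b%:~R : R|).
have [y [Xy ry xy]] := recurrent_dense k Xx.
have [t tE] := time_surj_recurrent s Xy ry; exists t.
have mono := le_mono (time_incr_recurrent Xy ry).
have ya : time y a%:~R = time x a%:~R by rewrite (H y xy) // le_max lexx.
have yb : time y b%:~R = time x b%:~R by rewrite (H y xy) // le_max lexx orbT.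
have at_ : a%:~R <= t by rewrite -mono tE ya.
have tb : t <= b%:~R by rewrite -mono tE yb.
rewrite -(H y xy) // le_max.
have [t0|t0] := leP 0 t.
  by apply/orP; right; rewrite ger0_norm // (le_trans tb) // ler_norm.
apply/orP; left; rewrite ltr0_norm // -normrN (le_trans _ (ler_norm _)) // lerN2 //.
Qed.

Definition shift_code (x : X0) : X0 := SigSub (mem_set (code_mem (set_valP x))).

Lemma code_torus_lift : torus_lift shift_code (fun (x : X0) i => off (set_val x) i)
  (fun (x : X0) t => time (set_val x) t).
Proof.
split.
- by move=> i x; apply: code_shift; exact: set_valP.
- by move=> i x t; exact: code_time_shift.
- move=> x m; have gx := code_grows n E (set_valP x).
  have [k Hk] := block_code_local s5 (@code_block_local n E) m gx.
  by exists k => y xy; exact: Hk.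
- by move=> x b; have [k Hk] := code_time_local n E (set_val x) b; exists k => y /Hk.
- by move=> x; apply: time_incr; exact: set_valP.
- by move=> x s; apply: time_surj; exact: set_valP.
Qed.

Definition code_map : mapping_torus R X0 -> mapping_torus R X0 :=
  lift_map shift_code (fun (x : X0) t => time (set_val x) t).

Lemma code_mapE (x : X0) t :
  code_map (torus_class x t) = torus_class (shift_code x) (time (set_val x) t).
Proof. exact: lift_mapE code_torus_lift x t. Qed.

Lemma code_map_cell (x : X0) L M t : trimmed L -> trimmed M ->
  cell L M (set_val x) -> 0 <= t < (size (cellword L M))%:R ->
  code_map (torus_class x t) = torus_class (shift_code x) (cmap L M t).
Proof.
move=> tL tM cx td; rewrite code_mapE.
have cx0 : cell L M (shift 0 (set_val x)) by rewrite shift0.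
by rewrite (@time_cell L M (set_val x) 0 t) ?add0r // offset0 add0r subr0.
Qed.

End TimeOnShift.
End CodeOnShift.

(** * The embedding *)

Notation cantor2 := (cantor_space * cantor_space)%type.

Definition realizes (f : cantor2 -> cantor2) (n : nat)
    (E : seq bool -> seq bool -> seq bool * seq bool) : Prop :=
  forall u v, size u = n -> size v = n -> forall x y,
    f (prefix_cat u x, prefix_cat v y) =
    (prefix_cat (E u v).1 x, prefix_cat (E u v).2 y).

Lemma realizes_exists f : acts_by_prefixes f ->
  exists nE : nat * (seq bool -> seq bool -> seq bool * seq bool),
    realizes f nE.1 nE.2.
Proof.
move=> /acts_by_prefixesP[n H].
have {}H (p : seq bool * seq bool) : exists q : seq bool * seq bool,
    size p.1 = n -> size p.2 = n -> forall x y,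
    f (prefix_cat p.1 x, prefix_cat p.2 y) = (prefix_cat q.1 x, prefix_cat q.2 y).
  have [su|su] := pselect (size p.1 = n); last by exists ([::], [::]).
  have [sv|sv] := pselect (size p.2 = n); last by exists ([::], [::]).
  by have [s [t st]] := H _ _ su sv; exists (s, t).
have [E HE] := choice H.
by exists (n, fun u v => E (u, v)) => u v su sv x y; exact: (HE (u, v)).
Qed.

Lemma star_pad f n E L M : realizes f n E ->
  (pad (star_left n E L M), pad (star_right n E L M)) = f (pad L, pad M).
Proof.
move=> fE; rewrite (pad_prefix n L) (pad_prefix n M) fE ?size_mkseq //.
by rewrite /star_left /star_right !pad_trim !pad_cat.
Qed.

(** A trimmed word is determined by the point of the Cantor space it pads to, so
    the composition law on cells is that of the homeomorphisms, whatever the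
    prefix lengths chosen for them. *)
Lemma star_comp f g h n E n' E' n'' E'' L M :
  realizes f n E -> realizes g n' E' -> realizes h n'' E'' ->
  (forall p, h p = f (g p)) ->
  star_left n E (star_left n' E' L M) (star_right n' E' L M) = star_left n'' E'' L M /\
  star_right n E (star_left n' E' L M) (star_right n' E' L M) = star_right n'' E'' L M.
Proof.
move=> fE gE hE hfg.
have := star_pad (star_left n' E' L M) (star_right n' E' L M) fE.
rewrite (star_pad L M gE) -hfg -(star_pad L M hE) => -[eL eM].
by split; apply: pad_inj => //; exact: trim_trimmed.
Qed.

Lemma star_id n E L M : realizes id n E -> trimmed L -> trimmed M ->
  star_left n E L M = L /\ star_right n E L M = M.
Proof.
move=> iE tL tM; have [eL eM] := star_pad L M iE.
by split; apply: pad_inj => //; exact: trim_trimmed.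
Qed.

Section TorusAction.
Variable R : realType.
Local Notation torus := (mapping_torus R X0).

Lemma recurrent_class (x : X0) (t : R) : recurrent (set_val x) ->
  exists (z : X0) L M (u : R), [/\ trimmed L, trimmed M, marked (set_val z),
    cell L M (set_val z) & 0 <= u < (size (cellword L M))%:R /\
    torus_class x t = torus_class z u].
Proof.
move=> rx; have [i [L [M [xi tL tM cx /andP[i1 i2]]]]] := cell_at t (set_valP x) rx.
exists (subshift_act i x), L, M, (t - i%:~R); split=> //.
  exact: marked_shift (set_valP x) rx xi.
split; last by rewrite (@torus_class_shift _ _ _ x).
by rewrite subr_ge0 i1 ltrBlDl; move: i2; rewrite intrD.
Qed.

Lemma recurrent_dense_points (x : X0) (m : nat) :
  exists2 y : X0, recurrent (set_val y) & agree m (set_val x) (set_val y).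
Proof.
have [y [Xy ry xy]] := recurrent_dense m (set_valP x).
by exists (SigSub (mem_set Xy)).
Qed.

Lemma code_map_continuous n E : continuous (code_map n E (R := R)).
Proof. exact: lift_map_continuous (code_torus_lift n E R). Qed.

(** On a cell both sides apply [cell_map] between the same lengths and write the
    same word. *)
Lemma code_map_comp f g h n E n' E' n'' E'' :
  realizes f n E -> realizes g n' E' -> realizes h n'' E'' ->
  (forall p, h p = f (g p)) ->
  forall z : torus, code_map n E (code_map n' E' z) = code_map n'' E'' z.
Proof.
move=> fE gE hE hfg.
have comp (x : full_shift 'I_6) : marked x ->
    block_code s5 (code_block n E) (block_code s5 (code_block n' E') x) =
    block_code s5 (code_block n'' E'') x.
  move: x; apply: cellwise_eq => L M x tL tM mx cx.
  have [eL eM] := star_comp L M fE gE hE hfg.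
  have [Xx rx _] := mx.
  have cx1 := @code_cell n' E' _ _ _ tL tM cx.
  have tL1 := star_left_trimmed n' E' L M; have tM1 := star_right_trimmed n' E' L M.
  have cx2 := @code_cell n E _ _ _ tL1 tM1 cx1.
  have cx3 := @code_cell n'' E'' _ _ _ tL tM cx.
  rewrite eL eM in cx2.
  exists (size (cellword (star_left n'' E'' L M) (star_right n'' E'' L M))).
  split; [by []| | |by move=> k kd; rewrite cx2 ?cx3].
    rewrite code_shift // (offset_cell n' E' tL tM cx) code_shift; last exact: code_mem.
    by rewrite (offset_cell n E tL1 tM1 cx1) eL eM.
  by rewrite code_shift // (offset_cell n'' E'' tL tM cx).
apply: (torus_dense_eq recurrent_dense_points).
- move=> z; apply: continuous_comp; exact: code_map_continuous.
- exact: code_map_continuous.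
move=> x t rx; have [z [L [M [u [tL tM mz cz [ud ->]]]]]] := recurrent_class t rx.
have [eL eM] := star_comp L M fE gE hE hfg.
rewrite (code_map_cell n' E' tL tM cz ud) (code_map_cell n'' E'' tL tM cz ud).
rewrite (code_map_cell n E (star_left_trimmed n' E' L M) (star_right_trimmed n' E' L M)).
- rewrite eL eM cell_map_comp; congr torus_class.
  by apply: val_inj; exact: comp.
- exact: code_cell.
- by rewrite size_cellword; apply: cell_map_range; rewrite -size_cellword.
Qed.

Lemma code_map_id n E : realizes id n E -> forall z : torus, code_map n E z = z.
Proof.
move=> iE.
have fixed (x : full_shift 'I_6) : marked x -> block_code s5 (code_block n E) x = x.
  move: x; apply: (@cellwise_eq _ id) => L M x tL tM mx cx.
  have [eL eM] := star_id iE tL tM; have [Xx rx _] := mx.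
  exists (size (cellword L M)); split; [by []| |by []|].
    by rewrite code_shift // (offset_cell n E tL tM cx) eL eM.
  move=> k kd; have := @code_cell n E _ _ _ tL tM cx.
  by rewrite eL eM => -> //; rewrite cx.
apply: (torus_dense_eq recurrent_dense_points).
- exact: code_map_continuous.
- by move=> z; exact: cvg_id.
move=> x t rx; have [z [L [M [u [tL tM mz cz [ud ->]]]]]] := recurrent_class t rx.
have [eL eM] := star_id iE tL tM.
rewrite (code_map_cell n E tL tM cz ud) eL eM cell_map_id; congr torus_class.
by apply: val_inj; exact: fixed.
Qed.

(** ** Points with a single centre detect the element of 2V *)

Definition centre_point (a b : cantor_space) : full_shift 'I_6 := fun i =>
  match i with
  | Posz 0 => s2
  | Posz k.+1 => rsym (b k)
  | Negz k => lsym (a k)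
  end.

Lemma centre_point_mem a b : subshift_set X0 (centre_point a b).
Proof.
apply/X0P => -[[|k]|[|k]].
- by rewrite add0r /=; case: (b 0%N).
- have -> : k.+1%:Z + 1 = k.+2%:Z by lia.
  by rewrite /=; do 2 case: (b _).
- have -> : Negz 0 + 1 = 0 by [].
  by rewrite /=; case: (a 0%N).
- have -> : Negz k.+1 + 1 = Negz k by lia.
  by rewrite /=; do 2 case: (a _).
Qed.

Lemma centre_point_centred a b (p q : nat) :
  centred (mkseq a p) (mkseq b q) (centre_point a b).
Proof.
split=> // k; rewrite size_mkseq => kp; rewrite nth_mkseq //.
Qed.

Lemma centre_point_unique a b i : centre_point a b i = s2 -> i = 0.
Proof. by case: i => [[|k]|k] //=; [case: (b k)|case: (a k)]. Qed.

Lemma lsym_inj : injective lsym. Proof. exact: pcan_inj lsymK. Qed.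
Lemma rsym_inj : injective rsym. Proof. exact: pcan_inj rsymK. Qed.

Section CentrePoint.
Variables (f : cantor2 -> cantor2) (n : nat).
Variable E : seq bool -> seq bool -> seq bool * seq bool.
Hypothesis fE : realizes f n E.
Variables a b : cantor_space.
Local Notation x := (centre_point a b).
Local Notation code := (block_code s5 (code_block n E)).
Local Notation c := ((size (new_left n E x))%:Z).

Lemma centre_point_reads m :
  reads m (left_tape x) (mkseq a m) /\ reads m (right_tape x) (mkseq b m).
Proof.
split; (split; last by rewrite size_mkseq ltnn) => k km _.
  have -> : left_tape x k = lbit (x (Negz k)) by congr (lbit (x _)); lia.
  by rewrite /= lsymK nth_mkseq.
by rewrite /right_tape /= rsymK nth_mkseq.
Qed.

Lemma centre_point_image : f (a, b) =
  (prefix_cat (new_left n E x) (fun i => a (n + i)%N),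
   prefix_cat (new_right n E x) (fun i => b (n + i)%N)).
Proof.
have [rL rR] := centre_point_reads n.+1; have [rL' rR'] := centre_point_reads n.
have mk (z : cantor_space) : mkseq (nth false (mkseq z n)) n = mkseq z n.
  apply: (@eq_from_nth _ false) => [|k]; rewrite !size_mkseq // => kn.
  by rewrite nth_mkseq.
rewrite /new_left /new_right /retrim (run_reads rL) (run_reads rR) !size_mkseq.
rewrite minnn ltnSn /written (tape_prefix_reads rL') (tape_prefix_reads rR') !mk.
by rewrite {1}(prefix_cat_mkseq n a) {1}(prefix_cat_mkseq n b) fE ?size_mkseq.
Qed.

Lemma code_centre_block k : (k < size (code_block n E x))%N ->
  code x k%:Z = nth s5 (rev (map lsym (new_left n E x)) ++
    s2 :: map rsym (new_right n E x)) k.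
Proof.
move=> kw; rewrite (@block_codeE _ s5 (code_block n E) x 0) offset0.
  by rewrite shift0 subr0.
by rewrite offsetS offset0 add0r shift0 ltz_nat kw.
Qed.

Lemma code_centre_size : size (code_block n E x) =
  (size (new_left n E x) + size (new_right n E x)).+1.
Proof. exact: (@size_code_centre n E _ _ _ (centre_point_centred a b 0 0)). Qed.

Lemma code_centre : code x c = s2.
Proof.
rewrite code_centre_block; last by rewrite code_centre_size; lia.
by rewrite nth_cat size_rev size_map ltnn subnn.
Qed.

Lemma code_centre_right k : code x (c + k.+1%:Z) = rsym ((f (a, b)).2 k).
Proof.
rewrite centre_point_image /= /prefix_cat; case: ltnP => ks.
  rewrite -PoszD code_centre_block; last by rewrite code_centre_size; lia.
  rewrite nth_cat size_rev size_map ifN; last by lia.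
  by rewrite addKn /= (nth_map false).
set j := (k - size (new_right n E x))%N.
have cen := centre_point_centred a b 0 (n + j).+1.
have blocks := right_blocks n E cen; rewrite size_mkseq in blocks.
have off1 : offset (code_block n E) x 1 = (size (code_block n E x))%:Z.
  by have := offsetS (code_block n E) x 0; rewrite offset0 !add0r shift0.
have h : (j < size (map rsym (drop n (mkseq b (n + j).+1))))%N.
  by rewrite size_map size_drop size_mkseq; lia.
have := block_code_segment s5 blocks h.
rewrite off1 code_centre_size (nth_map false); last by rewrite size_map in h.
rewrite nth_drop nth_mkseq; last by lia.
by move=> <-; congr (code x _); rewrite /j; lia.
Qed.

Lemma code_centre_left k : code x (c - k.+1%:Z) = lsym ((f (a, b)).1 k).
Proof.
rewrite centre_point_image /= /prefix_cat; case: ltnP => ks.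
  have -> : c - k.+1%:Z = (size (new_left n E x) - k.+1)%N%:Z by lia.
  rewrite code_centre_block; last by rewrite code_centre_size; lia.
  rewrite nth_cat size_rev size_map ifT; last by lia.
  rewrite nth_rev size_map; last by lia.
  rewrite (nth_map false); last by lia.
  by congr (lsym (nth _ _ _)); lia.
set j := (k - size (new_left n E x))%N.
have cen := centre_point_centred a b (n + j).+1 0.
have blocks := left_blocks n E cen; rewrite size_mkseq in blocks.
have sz : size (drop n (mkseq a (n + j).+1)) = j.+1.
  by rewrite size_drop size_mkseq; lia.
have h : (0 < size (rev (map lsym (drop n (mkseq a (n + j).+1)))))%N.
  by rewrite size_rev size_map sz.
have := block_code_segment s5 blocks h.
rewrite (offset_left n E cen) ?size_mkseq // nth_rev ?size_map ?sz //.
rewrite (nth_map false) ?sz ?subSS ?subn0 // nth_drop nth_mkseq; last by lia.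
by move=> <-; congr (code x _); rewrite /j; lia.
Qed.

End CentrePoint.

(** If the image of the point with a single centre is a shift of it, then the
    shift is the one that matches the centres, and hence the tapes. *)
Lemma code_map_orbits_id f n E : realizes f n E ->
  (forall z : torus, exists r, z = flow r (code_map n E z)) -> f =1 id.
Proof.
move=> fE orb [a b].
pose x : X0 := SigSub (mem_set (centre_point_mem a b)).
have [r] := orb (torus_class x 0).
rewrite code_mapE flowE => /torus_classP[m [xm _]].
have {}xm : block_code s5 (code_block n E) (centre_point a b) =
  shift m (centre_point a b) := xm.
have c0 := code_centre n E a b; rewrite xm /shift in c0.
have {}c0 := centre_point_unique c0.
rewrite [LHS]surjective_pairing; congr pair; apply/funext => k.
  apply: lsym_inj; rewrite -(code_centre_left fE) xm /shift.
  by have -> : (size (new_left n E (centre_point a b)))%:Z - k.+1%:Z + m = Negz k by lia.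
apply: rsym_inj; rewrite -(code_centre_right fE) xm /shift.
by have -> : (size (new_left n E (centre_point a b)))%:Z + k.+1%:Z + m = k.+1%:Z by lia.
Qed.

Lemma two_V_realized (f : brin_thompson_2V) :
  {nE : nat * (seq bool -> seq bool -> seq bool * seq bool) | realizes f nE.1 nE.2}.
Proof. by apply/cid/realizes_exists/asboolP/brin_thompson_valP. Qed.

Definition torus_map (f : brin_thompson_2V) : torus -> torus :=
  code_map (sval (two_V_realized f)).1 (sval (two_V_realized f)).2 (R := R).

Lemma torus_mapM (f g : brin_thompson_2V) z :
  torus_map (f * g)%g z = torus_map f (torus_map g z).
Proof.
apply/esym; apply: code_map_comp; try exact: (svalP (two_V_realized _)).
by [].
Qed.

Lemma torus_map1 z : torus_map 1%g z = z.
Proof. by apply: code_map_id; exact: (svalP (two_V_realized 1%g)). Qed.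

Lemma torus_map_homeomorphism f : homeomorphism (torus_map f).
Proof.
exists (torus_map (f^-1)%g); split; try exact: code_map_continuous.
  by move=> z; rewrite -torus_mapM mulVg torus_map1.
by move=> z; rewrite -torus_mapM mulgV torus_map1.
Qed.

Definition torus_homeo f : homeo torus := Homeo (asboolT (torus_map_homeomorphism f)).

Lemma torus_homeo_orientation f : preserves_orientation (torus_homeo f).
Proof. exact: lift_map_orientation (code_torus_lift _ _ R). Qed.

Definition torus_action f : torus_group R X0 :=
  TorusGroup (asboolT (torus_homeo_orientation f)).

Lemma torus_actionM f g : torus_action (f * g)%g = (torus_action f * torus_action g)%g.
Proof. by apply: torus_group_ext => z; exact: torus_mapM. Qed.

Definition embedding f : mapping_class_group R X0 := isotopy_class (torus_action f).

Lemma embeddingM : {morph embedding : f g / (f * g)%g >-> (f * g)%g}.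
Proof.
by move=> f g; rewrite /embedding torus_actionM; apply/esym; exact: mcg_mulE.
Qed.

HB.instance Definition _ := isMultiplicative.Build _ _ embedding embeddingM.

Lemma embedding_inj : injective embedding.
Proof.
move=> f g fg.
have : embedding (f * g^-1)%g = embedding 1%g.
  by rewrite embeddingM fg -embeddingM mulgV.
move=> /isotopy_classP iso; have fg1 : (f * g^-1)%g = 1%g.
  apply/val_inj/homeo_ext; apply: code_map_orbits_id.
    exact: (svalP (two_V_realized (f * g^-1)%g)).
  by move=> z; have [r rE] := isotopic_same_orbit z iso; exists r; rewrite -[LHS]torus_map1.
by rewrite -[f]mulg1 -(mulVg g) mulgA fg1 mul1g.
Qed.

End TorusAction.

Theorem theorem2 (R : realType) :
  exists phi : {multiplicative brin_thompson_2V ->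
      mapping_class_group R (vertex_shift (matrix_of_rows 6
        [:: [:: 1; 1; 1; 0; 0; 0];
            [:: 1; 1; 1; 0; 0; 0];
            [:: 0; 0; 0; 1; 1; 1];
            [:: 0; 0; 0; 1; 1; 0];
            [:: 0; 0; 0; 1; 1; 1];
            [:: 0; 1; 1; 0; 0; 0]]%N))},
    injective phi.
Proof. by exists (embedding R); exact: embedding_inj. Qed.
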